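(* Let $\mathcal{H}$ be a separable Hilbert space, $X$ a countable index set, and $\mathcal{A}=\mathcal{A}(X)$ a spectral algebra of $\mathcal{B}(\mathcal{H})$-valued matrices indexed by $X$. Let $T=(T_k)_{k\in X}$ be an intrinsically $\mathcal{A}$-localized g-frame for $\mathcal{H}$. Then: (i) the canonical dual g-frame $\widetilde{T}=(T_kS_T^{-1})_{k\in X}$ is intrinsically $\mathcal{A}$-localized; (ii) $T$ and $\widetilde{T}$ are mutually $\mathcal{A}$-localized.
   Context: g-frames. A family $T=(T_k)_{k\in X}$ in $\mathcal{B}(\mathcal{H})$ is a g-frame (operator-valued frame) for $\mathcal{H}$ if there are $0<A\le B<\infty$ with $A\|f\|^2\le\sum_{k\in X}\|T_kf\|^2\le B\|f\|^2$ for all $f\in\mathcal{H}$. Its g-frame operator $S_Tf=\sum_{k\in X}T_k^*T_kf$ is bounded, positive and invertible on $\mathcal{H}$; the canonical dual g-frame is $\widetilde T=(T_kS_T^{-1})_{k\in X}$. Matrices. $\ell^2(X;\mathcal{H})$ is the space of $\mathcal{H}$-valued sequences $(f_k)_{k\in X}$ with $\sum_k\|f_k\|^2<\infty$. A $\mathcal{B}(\mathcal{H})$-valued matrix $A=[A_{k,l}]_{k,l\in X}$ acts by $(Af)_k=\sum_{l\in X}A_{k,l}f_l$; bounded operators on $\ell^2(X;\mathcal{H})$ are identified with their $\mathcal{B}(\mathcal{H})$-valued matrices, products with matrix products, and adjoints with $[A_{k,l}]^*=[A_{l,k}^*]_{k,l\in X}$. Spectral algebra. A unital Banach *-algebra $\mathcal{A}$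 of $\mathcal{B}(\mathcal{H})$-valued matrices indexed by $X$ (with matrix multiplication and the involution $([A_{k,l}]_{k,l\in X})^*=[A_{l,k}^*]_{k,l\in X}$) is a spectral algebra if (1) $\mathcal{A}\subseteq\mathcal{B}(\ell^2(X;\mathcal{H}))$, i.e. the inclusion is a unital *-monomorphism; (2) $\mathcal{A}$ is inverse-closed: if $A\in\mathcal{A}$ is invertible in $\mathcal{B}(\ell^2(X;\mathcal{H}))$, then $A^{-1}\in\mathcal{A}$; (3) $\mathcal{A}$ is solid: if $A\in\mathcal{A}$ and $B=[B_{k,l}]$ is a $\mathcal{B}(\mathcal{H})$-valued matrix with $\|B_{k,l}\|\le\|A_{k,l}\|$ for all $k,l$, then $B\in\mathcal{A}$ and $\|B\|_{\mathcal{A}}\le\|A\|_{\mathcal{A}}$. Localization. For families $U=(U_k)_{k\in X}$, $T=(T_k)_{k\in X}$ in $\mathcal{B}(\mathcal{H})$ put $G_{U,T}=[U_kT_l^*]_{k,l\in X}$ and $G_T=G_{T,T}$. $U$ and $T$ are mutually $\mathcal{A}$-localized, $U\sim_{\mathcal{A}}T$, if $G_{U,T}\in\mathcal{A}$; $T$ is intrinsically $\mathcal{A}$-localized if $G_T\in\mathcal{A}$. *)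

(* Defs.v *)
From HB Require Import structures.
From mathcomp Require Import all_boot all_order all_algebra.
From mathcomp Require Import sesquilinear complex.
From mathcomp Require Import all_classical all_reals all_analysis.
From mathcomp Require summability.

Set Implicit Arguments.
Unset Strict Implicit.
Unset Printing Implicit Defensive.

Import Order.TTheory GRing.Theory Num.Theory.
Import numFieldNormedType.Exports.

Local Open Scope classical_set_scope.
Local Open Scope ring_scope.

(* A complex Hilbert space, with scalars R[i] for an arbitrary R : realType.
   The inner product is linear on the left and conjugate-linear on the right. *)
HB.mixin Record NormedModule_isHilbert (R : realType) H
    of CompleteNormedModule R[i] H := {
  hdot : {dot H for (@Num.conj R[i])};
  hdotE : forall x : H, `|x| ^+ 2 = hdot x x }.

#[short(type="hilbertType")]
HB.structure Definition Hilbert (R : realType) :=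
  { H of NormedModule_isHilbert R H & CompleteNormedModule R[i] H }.

Definition separable (T : topologicalType) : Prop :=
  exists2 D : set T, countable D & dense D.

(* The library norm of a complex normed module takes (nonnegative real) values
   in R[i]; this is the same norm with values in R. *)
Definition rnorm (R : realType) (V : normedModType R[i]) (x : V) : R :=
  complex.Re `|x|.

Section BoundedOperators.
Context {K : numFieldType}.
Implicit Type V : normedModType K.

Definition bounded_linear V : {pred V -> V} :=
  [pred f : V -> V |
    `[< linear f /\ exists r : K, forall x, `|f x| <= r * `|x| >]].

Lemma bounded_linearP V (f : V -> V) :
  reflect (linear f /\ exists r : K, forall x, `|f x| <= r * `|x|)
          (f \in @bounded_linear V).
Proof. exact: asboolP. Qed.

Lemma bounded_linear_submod_closed V : submod_closed (@bounded_linear V).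
Proof.
split=> [|a f g /bounded_linearP[lf [r fr]] /bounded_linearP[lg [s gs]]].
  apply/bounded_linearP; split=> [b x y|].
    by rewrite [RHS]addr0 [RHS]scaler0.
  by exists 0 => x; rewrite [X in `|X|](_ : _ = 0)// normr0 mul0r.
apply/bounded_linearP; split=> [b x y|].
  rewrite !fctE lf lg !scalerDr !scalerA (mulrC a b) -!addrA; congr (_ + _).
  by rewrite addrCA.
exists (`|a| * r + s) => x; rewrite !fctE mulrDl -mulrA.
by rewrite (le_trans (ler_normD _ _))// normrZ lerD// ler_wpM2l.
Qed.

HB.instance Definition _ V := GRing.isSubmodClosed.Build K (V -> V)
  (@bounded_linear V) (@bounded_linear_submod_closed V).

Record bounded_op V := BoundedOp {
  bounded_op_fun :> V -> V;
  bounded_opP : bounded_op_fun \in @bounded_linear V }.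

HB.instance Definition _ V := [isSub for @bounded_op_fun V].
HB.instance Definition _ V := [Choice of bounded_op V by <:].
HB.instance Definition _ V :=
  [SubChoice_isSubLmodule of bounded_op V by <:].

Lemma bounded_linear_id V : idfun \in @bounded_linear V.
Proof.
by apply/bounded_linearP; split=> //; exists 1 => x; rewrite mul1r.
Qed.

Lemma bounded_linear_comp V (f g : bounded_op V) :
  f \o g \in @bounded_linear V.
Proof.
have /bounded_linearP[lf [r fr]] := bounded_opP f.
have /bounded_linearP[lg [s gs]] := bounded_opP g.
apply/bounded_linearP; split=> [b x y|]; first by rewrite /= lg lf.
exists (`|r| * s) => x; have [x0|x0] := eqVneq (g x) 0.
  rewrite /= x0; have := fr 0; rewrite normr0 mulr0 => /le_trans; apply.
  by rewrite -mulrA mulr_ge0// (le_trans _ (gs x)).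
have r0 : 0 <= r.
  have := le_trans (normr_ge0 _) (fr (g x)).
  by rewrite pmulr_lge0// normr_gt0.
rewrite ger0_norm// -mulrA (le_trans (fr _))//.
by rewrite ler_wpM2l.
Qed.

Definition op_id V : bounded_op V := BoundedOp (bounded_linear_id V).

Definition op_comp V (f g : bounded_op V) : bounded_op V :=
  BoundedOp (bounded_linear_comp f g).

(* Two-sided inverse; 0 if there is none. *)
Definition op_inv V (f : bounded_op V) : bounded_op V :=
  xget 0 [set g : bounded_op V | cancel f g /\ cancel g f].

End BoundedOperators.

Section HilbertOperators.
Context {R : realType} {H : hilbertType R}.

Definition op_norm (f : bounded_op H) : R :=
  sup [set rnorm (f x) | x in [set x : H | rnorm x <= 1]].

(* The adjoint exists (Riesz) and is unique, so the default 0 is never used. *)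
Definition op_adj (f : bounded_op H) : bounded_op H :=
  xget 0 [set g : bounded_op H | forall x y : H, hdot (f x) y = hdot x (g y)].

End HilbertOperators.

Section Families.
Context {R : realType} {H : hilbertType R} {X : countType}.

(* Sums over X are unconditional: limits along the net of finite subsets. *)
Definition hsummable (x : X -> H) : Prop :=
  cvg (summability.partial_sum x @ summability.totally).

Definition hsum (x : X -> H) : H := summability.sum x.

Definition sqsum (f : X -> H) : \bar R :=
  (\esum_(k in [set: X]) (rnorm (f k) ^+ 2)%:E)%E.

Definition l2 (f : X -> H) : Prop := (sqsum f < +oo)%E.

Definition l2norm (f : X -> H) : R := Num.sqrt (fine (sqsum f)).

Definition gframe (T : X -> bounded_op H) : Prop :=
  exists A B : R, [/\ 0 < A, A <= B &
    forall f : H, ((A * rnorm f ^+ 2)%:E <= sqsum (fun k => T k f))%E /\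
                  (sqsum (fun k => T k f) <= (B * rnorm f ^+ 2)%:E)%E].

(* For a g-frame the sums converge and define a bounded operator, so the
   default 0 of insubd is not used. *)
Definition gframe_op (T : X -> bounded_op H) : bounded_op H :=
  insubd 0 (fun f : H => hsum (fun k => op_adj (T k) (T k f))).

Definition canonical_dual (T : X -> bounded_op H) : X -> bounded_op H :=
  fun k => op_comp (T k) (op_inv (gframe_op T)).

End Families.

Definition opmatrix (R : realType) (H : hilbertType R) (X : countType) :=
  X -> X -> bounded_op H.

HB.instance Definition _ (R : realType) (H : hilbertType R) (X : countType) :=
  GRing.Lmodule.on (opmatrix H X).

Section OperatorMatrices.
Context {R : realType} {H : hilbertType R} {X : countType}.
Implicit Types M N : opmatrix H X.

Definition opmx_act M (f : X -> H) : X -> H :=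
  fun k => hsum (fun l => M k l (f l)).

Definition opmx_one : opmatrix H X := fun k l => if k == l then op_id H else 0.

Definition opmx_star M : opmatrix H X := fun k l => op_adj (M l k).

(* The entries are the strongly convergent sums of M k m \o N m l over m.  When
   M and N act boundedly on l2 these sums do define bounded operators; in
   general the default 0 of insubd may be used. *)
Definition opmx_mul M N : opmatrix H X :=
  fun k l => insubd 0 (fun x : H => hsum (fun m => M k m (N m l x))).

Definition l2_bounded M : Prop :=
  (forall (f : X -> H) k, l2 f -> hsummable (fun l => M k l (f l))) /\
  exists C : R, forall f : X -> H, l2 f ->
    l2 (opmx_act M f) /\ l2norm (opmx_act M f) <= C * l2norm f.

Definition l2_inverse M N : Prop :=
  l2_bounded N /\
  forall f : X -> H, l2 f ->
    opmx_act N (opmx_act M f) = f /\ opmx_act M (opmx_act N f) = f.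

(* The ring and involution identities are not listed: for matrices acting
   boundedly on l2 they hold automatically.  Neither normA 1 = 1 nor
   normA (opmx_star M) = normA M is required. *)
Record banach_star_algebra (A : set (opmatrix H X)) (normA : opmatrix H X -> R)
    : Prop := BanachStarAlgebra {
  bsa_one : A opmx_one;
  bsa_zero : A 0;
  bsa_lin : forall (c : R[i]) M N, A M -> A N -> A (c *: M + N);
  bsa_mul : forall M N, A M -> A N -> A (opmx_mul M N);
  bsa_star : forall M, A M -> A (opmx_star M);
  bsa_norm_ge0 : forall M, A M -> 0 <= normA M;
  bsa_norm_eq0 : forall M, A M -> normA M = 0 -> M = 0;
  bsa_normZ : forall (c : R[i]) M, A M ->
    normA (c *: M) = complex.Re `|c| * normA M;
  bsa_normD : forall M N, A M -> A N -> normA (M + N) <= normA M + normA N;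
  bsa_normM : forall M N, A M -> A N ->
    normA (opmx_mul M N) <= normA M * normA N;
  bsa_complete : forall u : nat -> opmatrix H X, (forall n, A (u n)) ->
    (forall e : R, 0 < e -> exists n0 : nat, forall m n : nat,
       (n0 <= m)%N -> (n0 <= n)%N -> normA (u m - u n) < e) ->
    exists2 M, A M & normA (u n - M) @[n --> \oo] --> (0 : R) }.

Record spectral_algebra (A : set (opmatrix H X)) (normA : opmatrix H X -> R)
    : Prop := SpectralAlgebra {
  spa_banach : banach_star_algebra A normA;
  spa_bounded : A `<=` l2_bounded;
  spa_inverse_closed : forall M N, A M -> l2_inverse M N -> A N;
  spa_solid : forall M N, A M ->
    (forall k l, op_norm (N k l) <= op_norm (M k l)) ->
    A N /\ normA N <= normA M }.

Definition gram (U T : X -> bounded_op H) : opmatrix H X :=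
  fun k l => op_comp (U k) (op_adj (T l)).

Definition mutually_localized (A : set (opmatrix H X))
    (U T : X -> bounded_op H) : Prop := A (gram U T).

Definition intrinsically_localized (A : set (opmatrix H X))
    (T : X -> bounded_op H) : Prop := mutually_localized A T T.

End OperatorMatrices.

(* Main.v *)
(* With C the analysis operator and S = C^* C the frame operator, the Gram matrix
   is G = C C^*, and the two matrices of the theorem are C S^-2 C^*, the
   pseudo-inverse of G, and C S^-1 C^*, the projection P onto the range of C.
   Everything takes place among the matrices d + C L C^*, whose product is
   explicit in terms of d, L and S.

   The spectrum of G lies in {0} together with [a, +oo[, so for c = 2 / a the
   resolvent B(w) = (1 - c w^* G)^-1 exists for |w| = 1 and belongs to A by
   inverse-closedness; the resolvent identity and compactness of the circle make
   B Lipschitz for the norm of A.  Replacing F(w) by the mean of F over the two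
   square roots of w divides the Lipschitz constant of F on the circle by
   sqrt 2, so the iterated means of B at 1, which are (1 - (c G)^(2^m))^-1,
   form a Cauchy sequence in A.  Entrywise they converge to 1 - P, and solidity
   makes convergence in A imply entrywise convergence, so P is in A.  Finally
   G + (1 - P) is invertible with inverse C S^-2 C^* + (1 - P). *)

From HB Require Import structures.
Require Import Defs.
From mathcomp Require Import all_boot all_order all_algebra.
From mathcomp Require Import sesquilinear complex.
From mathcomp Require Import finmap ring lra.
From mathcomp Require Import all_classical all_reals all_analysis.
From mathcomp Require summability.

Set Implicit Arguments.
Unset Strict Implicit.
Unset Printing Implicit Defensive.

Import Order.TTheory GRing.Theory Num.Theory.
Import numFieldNormedType.Exports.

Local Open Scope classical_set_scope.
Local Open Scope ring_scope.

(** * Bounded operators on a Hilbert space *)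

Section RealNorm.
Context {R : realType} {V : normedModType R[i]}.
Implicit Types x y : V.

Lemma rnormE x : `|x| = (rnorm x)%:C%C.
Proof. by rewrite /rnorm RRe_real// normr_real. Qed.

Lemma rnorm_ge0 x : 0 <= rnorm x.
Proof. by rewrite -ler0c -rnormE. Qed.

Lemma rnorm0 : rnorm (0 : V) = 0.
Proof. by rewrite /rnorm normr0. Qed.

Lemma rnorm_eq0 x : rnorm x = 0 -> x = 0.
Proof. by move=> x0; apply/eqP; rewrite -normr_eq0 rnormE x0. Qed.

Lemma rnormN x : rnorm (- x) = rnorm x.
Proof. by rewrite /rnorm normrN. Qed.

Lemma rnormBC x y : rnorm (x - y) = rnorm (y - x).
Proof. by rewrite -rnormN opprB. Qed.

Lemma rnormD x y : rnorm (x + y) <= rnorm x + rnorm y.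
Proof. by rewrite -lecR rmorphD/= -!rnormE ler_normD. Qed.

Lemma rnorm_triangle x y z : rnorm (x - z) <= rnorm (x - y) + rnorm (y - z).
Proof. by rewrite (le_trans _ (rnormD _ _))// addrA subrK. Qed.

Lemma rnormZ (c : R[i]) x : rnorm (c *: x) = complex.Re `|c| * rnorm x.
Proof.
by apply: (@complexI R); rewrite -rnormE normrZ rmorphM/= -rnormE.
Qed.

Lemma rnormZr (c : R) x : rnorm (c%:C%C *: x) = `|c| * rnorm x.
Proof. by rewrite rnormZ normc_def/= expr0n/= addr0 sqrtr_sqr. Qed.

Lemma cvg_rnormP {T : Type} {F : set_system T} {FF : Filter F} (f : T -> V) l :
  f @ F --> l <-> forall e : R, 0 < e -> \forall t \near F, rnorm (l - f t) < e.
Proof.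
split=> [/cvgrPdist_lt fl e e0|fl].
  near=> t; rewrite -ltcR -rnormE; near: t; apply: fl; by rewrite ltcR.
(* The radius [e] lives in [R[i]]; being positive it is real, hence the image of its real part. *)
apply/cvgrPdist_lt => e e0; have eE : e = (complex.Re e)%:C%C.
  by rewrite RRe_real// gtr0_real.
near=> t; rewrite rnormE eE ltcR; near: t; apply: fl.
by rewrite -ltcR -eE.
Unshelve. all: by end_near. Qed.

End RealNorm.

(** A general proper filter covers sequences as well as the net of finite subsets. *)
Lemma cauchy_rnorm {R : realType} {V : completeNormedModType R[i]}
    {T : Type} {F : set_system T} {FF : ProperFilter F} (f : T -> V) :
  (forall e : R, 0 < e -> exists2 A, F A &
     forall s t, A s -> A t -> rnorm (f s - f t) < e) -> cvg (f @ F).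
Proof.
move=> fC; apply/cauchy_cvgP => /=; apply: cauchy_exP => e e0.
have eE : e = (complex.Re e)%:C%C by rewrite RRe_real// gtr0_real.
have [|A FA fA] := fC (complex.Re e); first by rewrite -ltcR -eE.
have [s As] := filter_ex FA; exists (f s).
suff: F (f @^-1` ball (f s) e) by [].
apply: (filterS _ FA) => t At; rewrite /= -ball_normE /= rnormE eE ltcR.
exact: fA.
Qed.

(** * The real part of the inner product *)

Section InnerProduct.
Context {R : realType} {H : hilbertType R}.
Implicit Types x y z : H.

(** Taking the real part keeps all estimates in the ordered field [R]; [hdot_ip] recovers the
    complex inner product. *)
Definition ip x y : R := complex.Re (hdot x y).

Lemma ReD (a b : R[i]) : complex.Re (a + b) = complex.Re a + complex.Re b.
Proof. by case: a b => [? ?] [? ?]. Qed.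

Lemma ReN (a : R[i]) : complex.Re (- a) = - complex.Re a.
Proof. by case: a. Qed.

Lemma ReZ (c : R) (a : R[i]) : complex.Re (c%:C%C * a) = c * complex.Re a.
Proof. by case: a => [? ?] /=; rewrite mul0r subr0. Qed.

Lemma Re_conj (a : R[i]) : complex.Re (Num.conj a) = complex.Re a.
Proof. by case: a. Qed.

Lemma ipDl x y z : ip (x + y) z = ip x z + ip y z.
Proof. by rewrite /ip linearDl ReD. Qed.

Lemma ipNl x z : ip (- x) z = - ip x z.
Proof. by rewrite /ip linearNl ReN. Qed.

Lemma ipZl (c : R) x z : ip (c%:C%C *: x) z = c * ip x z.
Proof. by rewrite /ip linearZl_LR ReZ. Qed.

Lemma ipC x y : ip x y = ip y x.
Proof. rewrite /ip [in LHS]hermC expr0 mul1r.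
exact: Re_conj. Qed.

Lemma ipDr x y z : ip z (x + y) = ip z x + ip z y.
Proof. by rewrite ipC ipDl !(ipC z). Qed.

Lemma ipNr x z : ip z (- x) = - ip z x.
Proof. by rewrite ipC ipNl (ipC z). Qed.

Lemma ipZr (c : R) x z : ip z (c%:C%C *: x) = c * ip z x.
Proof. by rewrite ipC ipZl (ipC z). Qed.

Lemma ip0l x : ip 0 x = 0.
Proof. by rewrite /ip linear0l. Qed.

Lemma ip_suml (I : Type) (r : seq I) (P : pred I) (f : I -> H) z :
  ip (\sum_(i <- r | P i) f i) z = \sum_(i <- r | P i) ip (f i) z.
Proof.
by apply: (big_morph (ip^~ z)) => [x y|]; [exact: ipDl|exact: ip0l].
Qed.

Lemma ipxx x : ip x x = rnorm x ^+ 2.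
Proof.
apply: (@complexI R); rewrite rmorphXn/= -rnormE hdotE /ip RRe_real//.
by rewrite ger0_real// dnorm_ge0.
Qed.

Lemma rnorm_sqrD x y : rnorm (x + y) ^+ 2 = rnorm x ^+ 2 + 2 * ip x y + rnorm y ^+ 2.
Proof. by rewrite -!ipxx !ipDl !ipDr (ipC y x); ring. Qed.

(** Expand [|s x - y|^2 >= 0] and divide by [s]. *)
Lemma ip_young (s : R) x y : 0 < s ->
  2 * ip x y <= s * rnorm x ^+ 2 + s^-1 * rnorm y ^+ 2.
Proof.
move=> s0; have := sqr_ge0 (rnorm (s%:C%C *: x - y)).
rewrite rnorm_sqrD rnormN rnormZr ipNr ipZl gtr0_norm// exprMn => h.
rewrite -subr_ge0 -(pmulr_rge0 _ s0).
by rewrite !(mulrBr, mulrDr) mulVKf ?gt_eqF//; nra.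
Qed.

Lemma ip_le x y : ip x y <= rnorm x * rnorm y.
Proof.
have [/rnorm_eq0->|x0] := eqVneq (rnorm x) 0; first by rewrite ip0l rnorm0 mul0r.
have [/rnorm_eq0->|y0] := eqVneq (rnorm y) 0.
  by rewrite ipC ip0l rnorm0 mulr0.
have xp : 0 < rnorm x by rewrite lt_def x0 rnorm_ge0.
have yp : 0 < rnorm y by rewrite lt_def y0 rnorm_ge0.
have := @ip_young (rnorm y / rnorm x) x y (divr_gt0 yp xp).
rewrite invfM invrK (_ : _ + _ = 2 * (rnorm x * rnorm y)); last by field; exact/andP.
by rewrite ler_pM2l.
Qed.

Lemma ip_ext x y : (forall z, ip z x = ip z y) -> x = y.
Proof.
move=> xy; apply/eqP; rewrite -subr_eq0; apply/eqP/rnorm_eq0.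
by apply/eqP; rewrite -sqrf_eq0 -ipxx ipDr ipNr xy subrr.
Qed.

(** By conjugate-linearity on the right, the imaginary part of [hdot x y] is the real part of
    [hdot x (i y)]. *)
Lemma hdot_ip x y : hdot x y = Complex (ip x y) (ip x ('i%C *: y)).
Proof.
rewrite /ip linearZr_LR /=; case: (hdot x y) => a b.
by rewrite (_ : Num.conj 'i%C = (0 -i* 1)%C)//= mul0r mulN1r opprK add0r.
Qed.

End InnerProduct.

(** The distance [d] is abstract so that the lemma serves both the norm of a complete space and
    [normA], which is controlled only on [A]. *)
Lemma geometric_cauchy {R : realType} (d : nat -> nat -> R) (C q : R) :
  0 <= C -> 0 <= q -> q < 1 ->
  (forall n, d n n = 0) -> (forall m n, d m n = d n m) ->
  (forall m n p, d m p <= d m n + d n p) ->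
  (forall n, d n.+1 n <= C * q ^+ n) ->
  forall e, 0 < e -> exists n0 : nat, forall m n : nat,
    (n0 <= m)%N -> (n0 <= n)%N -> d m n < e.
Proof.
move=> C0 q0 q1 d0 dC dD dq e e0.
have q1' : 0 < 1 - q by rewrite subr_gt0.
(* The geometric sum stays multiplied by [1 - q], so the induction involves no division. *)
have dnk n k : d (k + n)%N n * (1 - q) <= C * q ^+ n * (1 - q ^+ k).
  elim: k => [|k IH]; first by rewrite d0 expr0 subrr mul0r mulr0.
  rewrite (le_trans (ler_wpM2r (ltW q1') (dD _ (k + n)%N _)))// mulrDl.
  rewrite (le_trans (lerD (ler_wpM2r (ltW q1') (dq _)) IH))//.
  by rewrite exprD exprS -subr_ge0 (_ : _ - _ = 0)//; ring.
have dn n m : (n <= m)%N -> d m n <= C / (1 - q) * q ^+ n.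
  move=> nm; rewrite mulrAC ler_pdivlMr// -(subnK nm) (le_trans (dnk _ _))//.
  by rewrite ler_piMr ?mulr_ge0 ?exprn_ge0// gerBl exprn_ge0.
have /cvgrPdist_lt/(_ _ e0)[n0 _ n0P] :
    C / (1 - q) * q ^+ n @[n --> \oo] --> (0 : R).
  by apply: cvg_geometric; rewrite ger0_norm.
have dlt n m : (n0 <= n)%N -> (n <= m)%N -> d m n < e.
  move=> /n0P /= nP nm; rewrite (le_lt_trans (dn _ _ nm))//.
  by rewrite (le_lt_trans _ nP)// sub0r normrN ler_norm.
exists n0 => m n mP nP; have [nm|/ltnW mn] := leqP n m; first exact: dlt.
by rewrite dC dlt.
Qed.

Section BoundedOpTheory.
Context {R : realType} {V : normedModType R[i]}.
Implicit Types (f g : bounded_op V) (x y : V).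

Lemma bounded_op_is_linear f : linear f.
Proof. by have /bounded_linearP[] := bounded_opP f. Qed.

HB.instance Definition _ f :=
  GRing.isLinear.Build R[i] V V *:%R f (bounded_op_is_linear f).

Lemma bounded_op_rnorm f :
  exists2 r : R, 0 <= r & forall x, rnorm (f x) <= r * rnorm x.
Proof.
have /bounded_linearP[_ [r fr]] := bounded_opP f.
(* The given bound [r] lies in [R[i]]; comparing real parts lets [|Re r|] replace it. *)
exists `|complex.Re r| => // x.
have := fr x; rewrite !rnormE.
case: r {fr} => a b; rewrite lecE/= => /andP[_].
by rewrite mulr0 subr0 => /le_trans; apply; rewrite ler_wpM2r ?rnorm_ge0 ?ler_norm.
Qed.

Lemma bounded_op_intro (f : V -> V) (r : R) : linear f ->
  (forall x, rnorm (f x) <= r * rnorm x) -> f \in @bounded_linear _ V.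
Proof.
move=> lf fr; apply/bounded_linearP; split=> //; exists r%:C%C => x.
by rewrite !rnormE -rmorphM/= lecR.
Qed.

Lemma bounded_op_eq f g : f =1 g -> f = g.
Proof. by move=> fg; apply: val_inj; apply/funext. Qed.

Lemma opD f g x : (f + g) x = f x + g x. Proof. by []. Qed.

Lemma opZ (c : R[i]) f x : (c *: f) x = c *: f x. Proof. by []. Qed.

Lemma op_appD f x y : f (x + y) = f x + f y. Proof. exact: linearD. Qed.

Lemma op_appZ f (c : R[i]) x : f (c *: x) = c *: f x. Proof. exact: linearZ. Qed.

Lemma op_appN f x : f (- x) = - f x. Proof. exact: linearN. Qed.

Lemma op_appB f x y : f (x - y) = f x - f y. Proof. exact: linearB. Qed.

Lemma op_app0 f : f 0 = 0. Proof. exact: linear0. Qed.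

End BoundedOpTheory.

(** * Riesz representation and adjoints *)

Section Riesz.
Context {R : realType} {H : hilbertType R}.
Implicit Types x y : H.

(** Variational argument: a minimising sequence of [J x = |x|^2 - 2 phi x] is Cauchy, and
    near-minimality of its terms in every direction forces its limit to represent [phi]. *)
Lemma riesz (phi : H -> R) (r : R) :
  (forall x y, phi (x + y) = phi x + phi y) ->
  (forall (c : R) x, phi (c%:C%C *: x) = c * phi x) ->
  (forall x, phi x <= r * rnorm x) ->
  exists z, forall x, phi x = ip x z.
Proof.
move=> phiD phiZ phir; pose J x := rnorm x ^+ 2 - 2 * phi x.
have Jge x : - r ^+ 2 <= J x.
  have := phir x; have := sqr_ge0 (rnorm x - r); rewrite /J; nra.
pose m := inf (range J).
have hJ : has_inf (range J).
  by split; [exists (J 0), 0|exists (- r ^+ 2) => _ [x _ <-]].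
have mJ x : m <= J x by apply: (ge_inf hJ.2); exists x.
have JD x y : J (x + y) = J x + (2 * (ip x y - phi y) + rnorm y ^+ 2).
  by rewrite /J rnorm_sqrD phiD; ring.
have /choice[u uP] n : exists x, J x < m + n.+1%:R^-1 ^+ 2.
  have [|_ [x _ <-] xP] := @inf_adherent _ (range J) (n.+1%:R^-1 ^+ 2) _ hJ.
    by rewrite exprn_gt0.
  by exists x.
(* Parallelogram law, combined with [J >= m] at the midpoint of [x] and [y]. *)
have Jdist x y : rnorm (x - y) ^+ 2 <= 2 * (J x + J y - 2 * m).
  have := mJ ((2^-1)%:C%C *: (x + y)).
  rewrite /J rnorm_sqrD rnormN ipNr rnormZr exprMn phiZ phiD rnorm_sqrD.
  by rewrite ger0_norm ?invr_ge0//; nra.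
have inv_lt (e : R) : 0 < e -> \forall n \near \oo, n.+1%:R^-1 < e.
  by move=> e0; near=> n; near: n; exact: near_infty_natSinv_lt (PosNum e0).
have /cauchy_rnorm/cvg_ex[z uz] (e : R) : 0 < e -> exists2 A, \oo A &
    forall s t, A s -> A t -> rnorm (u s - u t) < e.
  move=> e0; exists [set n | n.+1%:R^-1 < e / 2]; first by apply: inv_lt; lra.
  move=> s t /= se te; rewrite -ltr_sqr ?nnegrE ?rnorm_ge0 ?ltW//.
  rewrite (le_lt_trans (Jdist _ _))//.
  have h k : k.+1%:R^-1 < e / 2 -> (k.+1%:R^-1 : R) ^+ 2 < e ^+ 2 / 4.
    move=> ke; have k0 : 0 <= (k.+1%:R^-1 : R) by [].
    by rewrite (_ : _ / 4 = (e / 2) ^+ 2) ?ltr_sqr ?nnegrE//; [lra|field].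
  have := uP s; have := uP t; move: (h _ se) (h _ te).
  move: (_ ^+ 2) (_^-1 ^+ 2) => a b; lra.
exists z => x; apply/eqP; rewrite -subr_eq0 -normr_eq0 eq_le normr_ge0 andbT.
apply/ler_addgt0Pr => e e0; rewrite add0r.
have x0 : 0 <= rnorm x by exact: rnorm_ge0.
(* Chosen so that the total error [d |x| + (d |x|^2 + d) / 2] is at most [e]. *)
pose d := e / (rnorm x + rnorm x ^+ 2 + 1).
have D0 : 0 < rnorm x + rnorm x ^+ 2 + 1 by nra.
have d0 : 0 < d by rewrite divr_gt0.
have de : d * (rnorm x + rnorm x ^+ 2 + 1) = e by rewrite divfK ?gt_eqF.
have [n [zn nd]] : exists n, rnorm (z - u n) < d /\ n.+1%:R^-1 < d.
  have FF : \forall n \near \oo, rnorm (z - u n) < d /\ n.+1%:R^-1 < d.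
    by apply: filterI; [move/cvg_rnormP: uz; apply|exact: inv_lt].
  exact: filter_ex FF.
(* [J (u n)] exceeds the infimum by less than [d^2], so a move by [s x] lowers it by less than that.
   Taking [s = d] and [s = - d] and dividing by [d] bounds [|ip (u n) x - phi x|]. *)
have key (s : R) : 0 <= 2 * s * (ip (u n) x - phi x) + s ^+ 2 * rnorm x ^+ 2 + d ^+ 2.
  have := mJ (u n + s%:C%C *: x); rewrite JD phiZ ipZr rnormZr exprMn.
  rewrite real_normK ?num_real//.
  have := uP n; have : (n.+1%:R^-1 : R) ^+ 2 < d ^+ 2.
    by rewrite ltr_sqr ?nnegrE ?(ltW d0).
  move: (_.+1%:R^-1 ^+ 2) => b; lra.
have k1 := key d; have k2 := key (- d).
have k3 := ip_le (z - u n) x; have k4 := ip_le (- (z - u n)) x.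
rewrite !(ipNl, ipDl, rnormN) in k3 k4.
have k5 : rnorm (z - u n) * rnorm x <= d * rnorm x by rewrite ler_wpM2r// ltW.
rewrite (ipC x); rewrite ler_norml; move: k1 k2.
set p := ip (u n) x - phi x => k1 k2.
have k6 : 0 <= d * (2 * p + d * rnorm x ^+ 2 + d) by lra.
have k7 : 0 <= d * (- 2 * p + d * rnorm x ^+ 2 + d) by lra.
rewrite !pmulr_rge0// in k6 k7.
have k8 : 0 <= d * rnorm x ^+ 2 by rewrite mulr_ge0 ?sqr_ge0// ltW.
rewrite /p in k6 k7; lra.
Unshelve. all: by end_near. Qed.

Lemma ipZ_adj (a : R[i]) x y : ip x (a *: y) = ip (Num.conj a *: x) y.
Proof. by rewrite /ip linearZl_LR linearZr_LR. Qed.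

(** [g y] is the Riesz vector of the real functional [ip (f x) y] of [x]. Uniqueness of that vector
    makes [g] complex linear, and [hdot_ip] then lifts the identity from real parts to [hdot]. *)
Lemma op_adj_exists (f : bounded_op H) :
  exists g : bounded_op H, forall x y, hdot (f x) y = hdot x (g y).
Proof.
have [r r0 fr] := bounded_op_rnorm f.
have /choice[g gP] y : exists z, forall x, ip (f x) y = ip x z.
  apply: (@riesz (fun x => ip (f x) y) (r * rnorm y)).
  - by move=> x x'; rewrite linearD ipDl.
  - by move=> c x; rewrite linearZ ipZl.
  - move=> x; rewrite (le_trans (ip_le _ _))// mulrAC.
    by rewrite ler_wpM2r ?rnorm_ge0.
have lg : linear g.
  move=> a y y'; apply: ip_ext => z.
  by rewrite -gP !ipDr !ipZ_adj -!gP linearZ.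
have bg y : rnorm (g y) <= r * rnorm y.
  have [->|gy] := eqVneq (rnorm (g y)) 0; first by rewrite mulr_ge0 ?rnorm_ge0.
  have gy0 : 0 < rnorm (g y) by rewrite lt_def gy rnorm_ge0.
  rewrite -(ler_pM2l gy0) -expr2 -ipxx -gP (le_trans (ip_le _ _))// mulrCA.
  by rewrite mulrA ler_wpM2r ?rnorm_ge0.
pose G := BoundedOp (bounded_op_intro lg bg); exists G => x y.
have gZ : g ('i%C *: y) = 'i%C *: g y by exact: (linearZ_LR G).
by rewrite !hdot_ip !gP gZ.
Qed.

Lemma ip_op_adj (f : bounded_op H) x y : ip (f x) y = ip x (op_adj f y).
Proof.
have [g gP] := op_adj_exists f; rewrite /ip /op_adj.
by case: xgetP => [h _ ->//|/(_ g)].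
Qed.

Lemma op_adj_uniq (f g : bounded_op H) :
  (forall x y, ip (f x) y = ip x (g y)) -> op_adj f = g.
Proof.
move=> fg; apply: bounded_op_eq => y; apply: ip_ext => x.
by rewrite -ip_op_adj fg.
Qed.

Lemma op_adj_comp (f g : bounded_op H) :
  op_adj (op_comp f g) = op_comp (op_adj g) (op_adj f).
Proof. by apply: op_adj_uniq => x y; rewrite /= !ip_op_adj. Qed.

End Riesz.

(** * Inverses by Neumann series *)

Section Inversion.
Context {R : realType} {V : completeNormedModType R[i]}.
Implicit Types (K U : bounded_op V) (x y z : V).

(** The solution is the fixed point of [x |-> z + K x]; the iterates from [0] are the partial sums
    of the Neumann series. *)
Lemma neumann_solve K (q : R) z : 0 <= q -> q < 1 ->
  (forall x, rnorm (K x) <= q * rnorm x) -> exists x, x - K x = z.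
Proof.
move=> q0 q1 Kq; pose u n := iter n (fun x => z + K x) 0.
have uS n : u n.+1 = z + K (u n) by [].
have du n : rnorm (u n.+1 - u n) <= rnorm z * q ^+ n.
  elim: n => [|n IH]; first by rewrite uS linear0 addr0 subr0 mulr1.
  rewrite 2!uS opprD addrACA subrr add0r -linearB (le_trans (Kq _))//.
  by rewrite exprS mulrCA ler_wpM2l.
have uC := @geometric_cauchy R (fun m n => rnorm (u m - u n)) (rnorm z) q
  (rnorm_ge0 _) q0 q1.
have /cauchy_rnorm/cvg_ex[l /= ul] (e : R) : 0 < e -> exists2 A, \oo A &
    forall s t, A s -> A t -> rnorm (u s - u t) < e.
  move=> /(uC _ _ _ du)[||m n p|n0 n0P].
  - by move=> n; rewrite subrr rnorm0.
  - by move=> m n; exact: rnormBC.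
  - exact: rnorm_triangle.
  - exists [set n | (n0 <= n)%N]; first by exists n0.
    by move=> s t /= sP tP; apply: n0P.
exists l; apply/eqP; rewrite -subr_eq0; apply/eqP/rnorm_eq0.
apply/eqP; rewrite eq_le rnorm_ge0 andbT; apply/ler_addgt0Pr => e e0.
rewrite add0r.
have /cvg_rnormP/(_ (e / 2))[|n0 _ n0P] := ul; first by lra.
have h1 : rnorm (l - u n0) < e / 2 by apply: n0P; exact: leqnn.
have h2 : rnorm (l - u n0.+1) < e / 2 by apply: n0P; exact: leqnSn.
have -> : l - K l - z = (l - u n0.+1) + K (u n0 - l).
  by rewrite uS linearB opprD !addrA addrNK addrAC.
rewrite (le_trans (rnormD _ _))//.
have := Kq (u n0 - l); rewrite [in X in _ <= X]rnormBC.
have := rnorm_ge0 (l - u n0); nra.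
Qed.

(** The bound [(1 - q) |x| <= |x - K x|] makes solutions unique; uniqueness makes the pointwise
    chosen solution linear, and the same bound controls its norm. *)
Lemma neumann_inverse K (q : R) : 0 <= q -> q < 1 ->
  (forall x, rnorm (K x) <= q * rnorm x) ->
  exists U, [/\ forall x, U x - K (U x) = x, forall x, U (x - K x) = x &
    forall x, rnorm (U x) <= (1 - q)^-1 * rnorm x].
Proof.
move=> q0 q1 Kq; have q1' : 0 < 1 - q by rewrite subr_gt0.
have /choice[U UP] z : exists x, x - K x = z by exact: neumann_solve Kq.
have Kb x : rnorm x <= (1 - q)^-1 * rnorm (x - K x).
  rewrite ler_pdivlMl//; have := rnormD (x - K x) (K x); rewrite subrK.
  by have := Kq x; lra.
have Kinj x y : x - K x = y - K y -> x = y.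
  move=> xy; apply/eqP; rewrite -subr_eq0; apply/eqP/rnorm_eq0/eqP.
  rewrite eq_le rnorm_ge0 andbT (le_trans (Kb _))//.
  suff -> : x - y - K (x - y) = (x - K x) - (y - K y).
    by rewrite xy subrr rnorm0 mulr0.
  by rewrite linearB !opprB addrACA [RHS]addrACA (addrC (- y)).
have lU : linear U.
  move=> a x y; apply: Kinj; rewrite UP linearP -{1}[x]UP -{1}[y]UP.
  by rewrite scalerBr opprD addrACA.
have bU x : rnorm (U x) <= (1 - q)^-1 * rnorm x by rewrite -{2}[x]UP.
exists (BoundedOp (bounded_op_intro lU bU)); split=> //= x.
by apply: Kinj; rewrite UP.
Qed.

End Inversion.

Section CoerciveInverse.
Context {R : realType} {H : hilbertType R}.
Implicit Types (S : bounded_op H) (x : H).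

(** For a suitable [tau] the operator [1 - tau S] is a strict contraction, so [tau S] is inverted by
    a Neumann series. Cauchy-Schwarz turns coercivity into the bound on [W]. *)
Lemma coercive_inverse S (a : R) : 0 < a ->
  (forall x, a * rnorm x ^+ 2 <= ip (S x) x) ->
  exists W : bounded_op H, [/\ cancel S W, cancel W S &
    forall x, a * rnorm (W x) <= rnorm x].
Proof.
move=> a0 Sa; have [r r0 Sr] := bounded_op_rnorm S.
(* Adding [a] to the bound of [S] makes [M] positive and at least [a], so that [q2] below is
   nonnegative. *)
pose M := r + a; have M0 : 0 < M by rewrite ltr_wpDl.
have aM : a <= M by rewrite lerDr.
(* |x - tau S x|^2 <= (1 - 2 tau a + tau^2 M^2) |x|^2, minimal at tau = a/M^2 *)
pose tau := a / M ^+ 2; have tau0 : 0 < tau by rewrite divr_gt0// exprn_gt0.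
pose q2 := 1 - (a / M) ^+ 2.
have q2ge : 0 <= q2.
  rewrite subr_ge0 exprn_ile1 ?divr_ge0 ?(ltW a0) ?(ltW M0)//.
  by rewrite ler_pdivrMr ?mul1r.
have q2lt : q2 < 1 by rewrite gtrBl exprn_gt0// divr_gt0.
pose K : bounded_op H := op_id H - tau%:C%C *: S.
have KE x : K x = x - tau%:C%C *: S x by [].
have Kq x : rnorm (K x) <= Num.sqrt q2 * rnorm x.
  rewrite -ler_sqr ?nnegrE ?mulr_ge0 ?rnorm_ge0 ?sqrtr_ge0//.
  rewrite exprMn sqr_sqrtr// KE rnorm_sqrD rnormN ipNr ipZr rnormZr gtr0_norm//.
  rewrite exprMn (ipC x).
  have SM : rnorm (S x) ^+ 2 <= M ^+ 2 * rnorm x ^+ 2.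
    rewrite -exprMn ler_sqr ?nnegrE ?mulr_ge0 ?rnorm_ge0 ?(ltW M0)//.
    by rewrite (le_trans (Sr _))// ler_wpM2r ?rnorm_ge0// lerDl ltW.
  have := ler_wpM2l (ltW tau0) (Sa x).
  have := ler_wpM2l (sqr_ge0 tau) SM.
  have -> : tau ^+ 2 * (M ^+ 2 * rnorm x ^+ 2) = (a / M) ^+ 2 * rnorm x ^+ 2.
    by rewrite /tau; field; rewrite gt_eqF.
  have -> : tau * (a * rnorm x ^+ 2) = (a / M) ^+ 2 * rnorm x ^+ 2.
    by rewrite /tau; field; rewrite gt_eqF.
  by rewrite /q2; lra.
have [|U [KU UK _]] := @neumann_inverse _ _ K (Num.sqrt q2) (sqrtr_ge0 _) _ Kq.
  by rewrite -sqrtr1 ltr_sqrt.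
have idK x : x - K x = tau%:C%C *: S x by rewrite KE opprB addrC subrK.
pose W := tau%:C%C *: U.
have SW : cancel W S.
  by move=> x; rewrite /W opZ linearZ -[LHS]/(tau%:C%C *: S (U x)) -idK KU.
exists W; split=> //.
  by move=> x; rewrite -[RHS]UK idK linearZ.
move=> x; have [->|Wx] := eqVneq (rnorm (W x)) 0; first by rewrite mulr0 rnorm_ge0.
have Wx0 : 0 < rnorm (W x) by rewrite lt_def Wx rnorm_ge0.
rewrite -(ler_pM2r Wx0) -mulrA -expr2 (le_trans (Sa _))// SW.
exact: ip_le.
Qed.

End CoerciveInverse.

(** * Unconditional sums, frames and their operator matrices *)

#[local] Existing Instance summability.totally_filter.

Lemma big_fset_split {V : nmodType} {K : choiceType} (F J : {fset K}) (x : K -> V) :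
  (F `<=` J)%fset ->
  \sum_(k <- J) x k = \sum_(k <- (J `\` F)%fset) x k + \sum_(k <- F) x k.
Proof.
move=> FJ; rewrite (big_fsetID _ (mem F)) [RHS]addrC /=.
congr (_ + _); apply: eq_fbigl => k; rewrite !inE/=; last by rewrite andbC.
by rewrite andb_idl//; exact: (fsubsetP FJ).
Qed.

Section Sums.
Context {R : realType} {H : hilbertType R} {X : countType}.
Implicit Types (x y : X -> H) (J F : {fset X}).

(** [hsum] is meaningful only for convergent families; the relation carries convergence and value
    together. *)
Definition has_hsum x (l : H) : Prop :=
  summability.partial_sum x @ summability.totally --> l.

Lemma has_hsumP x l : has_hsum x l <-> forall e : R, 0 < e ->
  exists F, forall J, (F `<=` J)%fset -> rnorm (l - \sum_(k <- J) x k) < e.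
Proof.
have psE J : summability.partial_sum x J = \sum_(k <- J) x k.
  by rewrite /summability.partial_sum big_seq_fsetE.
split=> [/cvg_rnormP xl e /xl[F _ FP]|xl].
  by exists F => J /FP; rewrite /= psE.
apply/cvg_rnormP => e /xl[F FP]; exists F => // J FJ /=.
by rewrite psE FP.
Qed.

Lemma has_hsum_hsum x l : has_hsum x l -> hsum x = l.
Proof. by move=> xl; apply: cvg_lim. Qed.

Lemma has_hsum_hsummable x l : has_hsum x l -> hsummable x.
Proof. by move=> xl; apply/cvg_ex; exists l. Qed.

Lemma has_hsum_uniq x l l' : has_hsum x l -> has_hsum x l' -> l = l'.
Proof. by move=> /has_hsum_hsum <- /has_hsum_hsum. Qed.

Lemma has_hsumD x y l m : has_hsum x l -> has_hsum y m ->
  has_hsum (fun k => x k + y k) (l + m).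
Proof.
move=> /has_hsumP xl /has_hsumP ym; apply/has_hsumP => e e0.
have [|F FP] := xl (e / 2); first by lra.
have [|G GP] := ym (e / 2); first by lra.
exists (F `|` G)%fset => J; rewrite fsubUset => /andP[FJ GJ].
rewrite big_split/= opprD addrACA (le_lt_trans (rnormD _ _))//.
by have := FP _ FJ; have := GP _ GJ; lra.
Qed.

Lemma has_hsum_op (f : bounded_op H) x l : has_hsum x l ->
  has_hsum (fun k => f (x k)) (f l).
Proof.
have [r r0 fr] := bounded_op_rnorm f.
move=> /has_hsumP xl; apply/has_hsumP => e e0.
have r1 : 0 < r + 1 by lra.
have [|F FP] := xl (e / (r + 1)); first by rewrite divr_gt0.
exists F => J /FP; rewrite ltr_pdivlMr// => h.
rewrite -linear_sum -linearB (le_lt_trans (fr _))//.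
by have := rnorm_ge0 (l - \sum_(k <- J) x k); nra.
Qed.

Lemma has_hsumZ (c : R[i]) x l : has_hsum x l ->
  has_hsum (fun k => c *: x k) (c *: l).
Proof. exact: (@has_hsum_op (c *: op_id H)). Qed.

Lemma has_hsum_single k0 (z : H) : has_hsum (fun k => if k0 == k then z else 0) z.
Proof.
apply/has_hsumP => e e0; exists [fset k0]%fset => J.
rewrite fsub1set => kJ; rewrite (big_fsetD1 k0)//= eqxx big1_fset.
  by rewrite addr0 subrr rnorm0.
by move=> k; rewrite in_fsetD1 eq_sym => /andP[/negPf ->].
Qed.

(** Two finite sets containing [F] share the sum over [F], so their sums differ by two sums over
    sets disjoint from [F]. *)
Lemma has_hsum_cauchy x : (forall e : R, 0 < e -> exists F,
    forall J, [disjoint J & F]%fset -> rnorm (\sum_(k <- J) x k) < e) ->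
  has_hsum x (hsum x).
Proof.
move=> xC; suff /cvg_ex[l xl] : hsummable x by rewrite (has_hsum_hsum xl).
apply: cauchy_rnorm => e e0; have [|F FP] := xC (e / 2); first by lra.
exists [set J | (F `<=` J)%fset]; first by exists F.
have hF J : (F `<=` J)%fset ->
    summability.partial_sum x J =
    \sum_(k <- (J `\` F)%fset) x k + \sum_(k <- F) x k.
  move=> FJ; rewrite /summability.partial_sum -(big_seq_fsetE _ J predT)/=.
  exact: big_fset_split.
move=> J J' /= /hF -> /hF ->; rewrite opprD addrACA subrr addr0.
rewrite (le_lt_trans (rnormD _ _))// rnormN.
have := FP (J `\` F)%fset; have := FP (J' `\` F)%fset.
have D J0 : [disjoint J0 `\` F & F]%fset.
  by apply/fdisjointP => k; rewrite inE => /andP[].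
by move=> /(_ (D _)) h1 /(_ (D _)); lra.
Qed.

Lemma has_hsum_le x l (C : R) : has_hsum x l ->
  (forall J, rnorm (\sum_(k <- J) x k) <= C) -> rnorm l <= C.
Proof.
move=> /has_hsumP xl xC; apply/ler_addgt0Pr => e /xl[F FP].
have := FP F (fsubset_refl _); have := xC F.
have := rnormD (l - \sum_(k <- F) x k) (\sum_(k <- F) x k).
by rewrite subrK; lra.
Qed.

Lemma sqsum_ge_fset (f : X -> H) J :
  ((\sum_(k <- J) rnorm (f k) ^+ 2)%:E <= sqsum f)%E.
Proof.
rewrite -sumEFin; apply: ereal_sup_ubound; exists [set` J]; first by split.
by rewrite fsbig_finite//= set_fsetK.
Qed.

Lemma sqsum_le (f : X -> H) (C : R) :
  (forall J, \sum_(k <- J) rnorm (f k) ^+ 2 <= C) -> (sqsum f <= C%:E)%E.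
Proof.
move=> fC; apply: ge_ereal_sup => _ [A [finA _] <-].
by rewrite fsbig_finite//= sumEFin lee_fin.
Qed.

Lemma sqsum_ge0 (f : X -> H) : (0 <= sqsum f)%E.
Proof. by apply: esum_ge0 => k _; rewrite lee_fin sqr_ge0. Qed.

Lemma l2_fin (f : X -> H) : l2 f -> sqsum f = ((l2norm f) ^+ 2)%:E.
Proof.
move=> f2; rewrite /l2norm sqr_sqrtr ?fine_ge0 ?sqsum_ge0//.
by rewrite fineK// ge0_fin_numE ?sqsum_ge0.
Qed.

Lemma l2_fset (f : X -> H) J : l2 f ->
  \sum_(k <- J) rnorm (f k) ^+ 2 <= l2norm f ^+ 2.
Proof. by move=> /l2_fin f2; rewrite -lee_fin -f2 sqsum_ge_fset. Qed.

Lemma l2_bounded_fset (f : X -> H) (C : R) :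
  (forall J, \sum_(k <- J) rnorm (f k) ^+ 2 <= C ^+ 2) -> 0 <= C ->
  l2 f /\ l2norm f <= C.
Proof.
move=> /sqsum_le fC C0; have f2 : l2 f by rewrite /l2 (le_lt_trans fC)// ltry.
split=> //; rewrite -ler_sqr ?nnegrE ?sqrtr_ge0//.
by rewrite -lee_fin -l2_fin.
Qed.

(** A finite set whose sum comes within [e] of the supremum leaves less than [e] for any finite set
    disjoint from it. *)
Lemma l2_tail (f : X -> H) (e : R) : l2 f -> 0 < e -> exists F,
  forall J, [disjoint J & F]%fset -> \sum_(k <- J) rnorm (f k) ^+ 2 < e.
Proof.
move=> f2 e0; have ff := l2_fin f2.
have [|_ [A [finA _] <-] AP] := @ub_ereal_sup_adherent _
  [set (\sum_(x \in A) (rnorm (f x) ^+ 2)%:E)%E | A in fsets [set: X]] e e0.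
  by rewrite -[ereal_sup _]/(sqsum f) ff.
exists (fset_set A) => J JA.
move: AP; rewrite -[ereal_sup _]/(sqsum f) ff fsbig_finite//= sumEFin -EFinB.
rewrite lte_fin; have := l2_fset (J `|` fset_set A)%fset f2.
rewrite (big_fset_split _ (fsubsetUr J (fset_set A))).
by rewrite fsetDUl fsetDv fsetU0 (fsetDidPl _ _ JA); lra.
Qed.

End Sums.

Arguments has_hsum_single {R H X} k0 z.
Arguments has_hsum_op {R H X} f {x l} _.
Arguments has_hsumZ {R H X} c {x l} _.

(** * Analysis, synthesis and the frame operator *)

Section Frames.
Context {R : realType} {H : hilbertType R} {X : countType}.
Variables (T : X -> bounded_op H) (a b : R).
Hypotheses (a0 : 0 < a) (b0 : 0 < b).
Hypothesis lower : forall x, ((a * rnorm x ^+ 2)%:E <= sqsum (fun k => T k x))%E.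
Hypothesis upper : forall x, (sqsum (fun k => T k x) <= (b * rnorm x ^+ 2)%:E)%E.
Implicit Types (f : X -> H) (x y : H) (J F : {fset X}).

Let C x : X -> H := fun k => T k x.

Definition synthesis f : H := hsum (fun k => op_adj (T k) (f k)).

Lemma analysis_fset x J : \sum_(k <- J) rnorm (T k x) ^+ 2 <= b * rnorm x ^+ 2.
Proof. by rewrite -lee_fin (le_trans (sqsum_ge_fset _ _))//; exact: upper. Qed.

Lemma analysis_l2 x : l2 (C x) /\ l2norm (C x) <= Num.sqrt b * rnorm x.
Proof.
apply: l2_bounded_fset; last by rewrite mulr_ge0 ?sqrtr_ge0 ?rnorm_ge0.
by move=> J; rewrite exprMn sqr_sqrtr ?(ltW b0)//; exact: analysis_fset.
Qed.

(* Duality: with v the left-hand sum, |v|^2 = sum <f_k, T_k v>, and AM-GM absorbs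
   the terms |T_k v|^2 by the upper frame bound. *)
Lemma synthesis_fset f J :
  rnorm (\sum_(k <- J) op_adj (T k) (f k)) ^+ 2 <=
  b * \sum_(k <- J) rnorm (f k) ^+ 2.
Proof.
set v := \sum_(k <- J) _; have vv : rnorm v ^+ 2 = \sum_(k <- J) ip (f k) (T k v).
  rewrite -ipxx {1}/v ip_suml; apply: eq_bigr => k _.
  by rewrite ipC -ip_op_adj ipC.
have : \sum_(k <- J) 2 * ip (f k) (T k v) <=
    \sum_(k <- J) (b * rnorm (f k) ^+ 2 + b^-1 * rnorm (T k v) ^+ 2).
  by apply: ler_sum => k _; exact: ip_young.
rewrite big_split/= -!mulr_sumr -vv => h.
have := analysis_fset v J; rewrite -ler_pdivrMl// => h'.
by lra.
Qed.

(** By [synthesis_fset], small tails of the square sum of [f] give small tails of the synthesis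
    sum. *)
Lemma has_hsum_synthesis f : l2 f ->
  has_hsum (fun k => op_adj (T k) (f k)) (synthesis f).
Proof.
move=> f2; apply: has_hsum_cauchy => e e0.
have [|F FP] := @l2_tail _ _ _ f (b^-1 * e ^+ 2) f2.
  by rewrite mulr_gt0 ?invr_gt0// exprn_gt0.
exists F => J /FP; rewrite ltr_pdivlMl// => h.
rewrite -ltr_sqr ?nnegrE ?rnorm_ge0 ?(ltW e0)//.
exact: le_lt_trans (synthesis_fset _ _) h.
Qed.

Lemma synthesis_bound f : l2 f -> rnorm (synthesis f) <= Num.sqrt b * l2norm f.
Proof.
move=> f2; apply: (has_hsum_le (has_hsum_synthesis f2)) => J.
rewrite -ler_sqr ?nnegrE ?mulr_ge0 ?rnorm_ge0 ?sqrtr_ge0//.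
rewrite exprMn sqr_sqrtr ?(ltW b0)// (le_trans (synthesis_fset _ _))//.
by rewrite ler_pM2l// l2_fset.
Qed.

Lemma has_hsum_frame x :
  has_hsum (fun k => op_adj (T k) (T k x)) (gframe_op T x).
Proof.
have hs y := has_hsum_synthesis (analysis_l2 y).1.
(* [gframe_op] is built with [insubd]; once [C^* C] is known to be linear and bounded, the default
   [0] is excluded. *)
suff bS : (fun x => synthesis (C x)) \in @bounded_linear _ H.
  by rewrite /gframe_op (insubdK _ bS); exact: hs.
apply: (@bounded_op_intro _ _ _ b) => [c y z|y].
  apply: (has_hsum_uniq (hs _)).
  have := has_hsumD (has_hsumZ c (hs y)) (hs z).
  by under eq_fun do rewrite -linearP -linearP.
rewrite (le_trans (synthesis_bound (analysis_l2 y).1))//.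
rewrite -{2}[b]sqr_sqrtr ?(ltW b0)// expr2 -mulrA ler_wpM2l ?sqrtr_ge0//.
exact: (analysis_l2 y).2.
Qed.

Arguments has_hsum_frame : clear implicits.

(** Symmetry is exact for partial sums over a common finite set, and these approximate both values
    of the frame operator. *)
Lemma gframe_op_sym x y : ip (gframe_op T x) y = ip x (gframe_op T y).
Proof.
apply/eqP; rewrite -subr_eq0 -normr_eq0 eq_le normr_ge0 andbT.
apply/ler_addgt0Pr => e e0; rewrite add0r.
pose d := e / (rnorm x + rnorm y + 1).
have D0 : 0 < rnorm x + rnorm y + 1.
  by have := rnorm_ge0 x; have := rnorm_ge0 y; lra.
have d0 : 0 < d by rewrite divr_gt0.
have de : d * (rnorm x + rnorm y + 1) = e by rewrite divfK ?gt_eqF.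
have /has_hsumP/(_ d d0)[F FP] := has_hsum_frame x.
have /has_hsumP/(_ d d0)[G GP] := has_hsum_frame y.
have := FP _ (fsubsetUl F G); have := GP _ (fsubsetUr F G).
set J := (F `|` G)%fset; set u := \sum_(k <- J) _; set v := \sum_(k <- J) _.
have uv : ip x u = ip v y.
  rewrite ipC !ip_suml; apply: eq_bigr => k _.
  by rewrite ipC -ip_op_adj ipC ip_op_adj ipC.
move=> h1 h2.
have -> : ip (gframe_op T x) y - ip x (gframe_op T y) =
    ip (gframe_op T x - v) y - ip x (gframe_op T y - u).
  by rewrite ipDl ipNl ipDr ipNr uv; ring.
have i1 := ip_le (gframe_op T x - v) y.
have i2 := ip_le (- (gframe_op T x - v)) y.
have i3 := ip_le x (gframe_op T y - u).
have i4 := ip_le (- x) (gframe_op T y - u).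
rewrite !(ipNl, rnormN) in i2 i4.
have y0 := rnorm_ge0 y; have x0 := rnorm_ge0 x.
have j1 : rnorm (gframe_op T x - v) * rnorm y <= d * rnorm y.
  by rewrite ler_wpM2r// ltW.
have j2 : rnorm x * rnorm (gframe_op T y - u) <= rnorm x * d.
  by rewrite ler_wpM2l// ltW.
by rewrite ler_norml; lra.
Qed.

(** Up to [e], the form [ip (S x) x] dominates every finite sum of [|T_k x|^2]: enlarging the index
    set only adds nonnegative terms. The lower frame bound concludes. *)
Lemma gframe_op_coercive x : a * rnorm x ^+ 2 <= ip (gframe_op T x) x.
Proof.
rewrite -lee_fin (le_trans (lower x))//; apply: sqsum_le => J.
apply/ler_addgt0Pr => e e0.
have x0 := rnorm_ge0 x; have x1 : 0 < rnorm x + 1 by lra.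
have /has_hsumP/(_ (e / (rnorm x + 1)))[|F FP] := has_hsum_frame x.
  by rewrite divr_gt0.
have := FP _ (fsubsetUr J F); rewrite ltr_pdivlMr//.
set v := \sum_(k <- _) _ => h.
have h' := ip_le (- (gframe_op T x - v)) x.
rewrite rnormN ipNl ipDl ipNl in h'.
have vv : ip v x = \sum_(k <- (J `|` F)%fset) rnorm (T k x) ^+ 2.
  by rewrite ip_suml; apply: eq_bigr => k _; rewrite ipC -ip_op_adj ipxx.
have : \sum_(k <- J) rnorm (T k x) ^+ 2 <= ip v x.
  rewrite vv (big_fset_split _ (fsubsetUl J F)) lerDr sumr_ge0// => k _.
  exact: sqr_ge0.
by have := rnorm_ge0 (gframe_op T x - v); nra.
Qed.

(** Two-sided inverses are unique, so [op_inv] returns this [W] and not its default; [W] inherits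
    self-adjointness from the symmetry of the frame operator. *)
Lemma gframe_op_inverse : exists W : bounded_op H,
  [/\ cancel (gframe_op T) W, cancel W (gframe_op T),
      op_inv (gframe_op T) = W, op_adj W = W &
      forall x, a * rnorm (W x) <= rnorm x].
Proof.
have [W [SW WS Wa]] := coercive_inverse a0 gframe_op_coercive.
exists W; split=> //.
  rewrite /op_inv; case: xgetP => [V _ [SV VS]|/(_ W)/=]; last by case.
  by apply: bounded_op_eq => x; rewrite -[in LHS](WS x) SV.
apply: op_adj_uniq => x y.
by rewrite -[y in LHS]WS -gframe_op_sym WS.
Qed.

End Frames.

Arguments has_hsum_frame {R H X T b} b0 upper x.

(** * The operator norm *)

Section OperatorNorm.
Context {R : realType} {H : hilbertType R}.
Implicit Types (f g : bounded_op H) (x : H).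

Lemma op_norm_has_sup f :
  has_sup [set rnorm (f x) | x in [set x : H | rnorm x <= 1]].
Proof.
split; first by exists (rnorm (f 0)), 0; rewrite //= rnorm0.
have [r r0 fr] := bounded_op_rnorm f; exists r => _ [x /= x1 <-].
by rewrite (le_trans (fr _))// ler_piMr.
Qed.

Lemma op_norm_ge0 f : 0 <= op_norm f.
Proof.
apply: (le_trans (rnorm_ge0 (f 0))); apply: ub_le_sup.
  exact: (op_norm_has_sup f).2.
by exists 0; rewrite //= rnorm0.
Qed.

Lemma op_norm_ub f x : rnorm (f x) <= op_norm f * rnorm x.
Proof.
have [x0|x0] := eqVneq (rnorm x) 0.
  by rewrite (rnorm_eq0 x0) linear0 rnorm0 mulr0.
have xp : 0 < rnorm x by rewrite lt_def x0 rnorm_ge0.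
rewrite -ler_pdivrMr// mulrC.
rewrite -[(rnorm x)^-1]gtr0_norm ?invr_gt0// -rnormZr -linearZ.
apply: ub_le_sup; first exact: (op_norm_has_sup f).2.
by eexists; last reflexivity; rewrite /= rnormZr gtr0_norm ?invr_gt0// mulVf.
Qed.

Lemma op_norm_le f (c : R) : 0 <= c ->
  (forall x, rnorm (f x) <= c * rnorm x) -> op_norm f <= c.
Proof.
move=> c0 fc; apply: ge_sup; first exact: (op_norm_has_sup f).1.
by move=> _ [x /= x1 <-]; rewrite (le_trans (fc _))// ler_piMr.
Qed.

Lemma op_norm0 : op_norm (0 : bounded_op H) = 0.
Proof.
apply/eqP; rewrite eq_le op_norm_ge0 andbT op_norm_le// => x.
by rewrite mul0r rnorm0.
Qed.

Lemma op_norm_eq0 f : op_norm f = 0 -> f = 0.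
Proof.
move=> f0; apply: bounded_op_eq => x; apply/rnorm_eq0/eqP.
by rewrite eq_le rnorm_ge0 andbT (le_trans (op_norm_ub _ _))// f0 mul0r.
Qed.

Lemma op_normZ_le (c : R) f : 0 <= c -> op_norm (c%:C%C *: f) <= c * op_norm f.
Proof.
move=> c0; apply: op_norm_le => [|x]; first by rewrite mulr_ge0 ?op_norm_ge0.
by rewrite opZ rnormZr ger0_norm// -mulrA ler_wpM2l// op_norm_ub.
Qed.

End OperatorNorm.

Section SpectralAlgebra.
Context {R : realType} {H : hilbertType R} {X : countType}.
Variables (A : set (opmatrix H X)) (normA : opmatrix H X -> R).
Hypothesis spA : spectral_algebra A normA.

(* Solidity bounds the norm of [M] below by that of the multiple of a fixed
   one-entry matrix whose entry has the same norm as [M k l]. *)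
Lemma spectral_algebra_entry (k l : X) : exists2 K : R, 0 <= K &
  forall M, A M -> op_norm (M k l) <= K * normA M.
Proof.
have [bA _ _ solid] := spA.
(* If every matrix of [A] vanishes at [(k, l)], then [K = 0] works; otherwise a nonzero entry yields
   the one-entry matrix [E]. *)
have [[M [AM M0]]|noM] := pselect (exists M, A M /\ M k l != 0); last first.
  exists 0 => // M AM; rewrite mul0r.
  have [->|Mkl] := eqVneq (M k l) 0; first by rewrite op_norm0.
  by exfalso; apply: noM; exists M.
have n0 : 0 < op_norm (M k l).
  by rewrite lt_def op_norm_ge0 andbT; apply: contra_neq M0 => /op_norm_eq0.
pose E : opmatrix H X := fun i j => if (i == k) && (j == l) then M k l else 0.
have [AE _] : A E /\ normA E <= normA M.
  apply: solid => // i j; rewrite /E; case: ifP => [/andP[/eqP-> /eqP->]//|_].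
  by rewrite op_norm0 op_norm_ge0.
have E0 : 0 < normA E.
  rewrite lt_def (bsa_norm_ge0 bA)// andbT; apply: contra_neq M0.
  move=> /(bsa_norm_eq0 bA AE)/(congr1 (fun N : opmatrix H X => N k l)).
  by rewrite /E !eqxx.
exists (op_norm (M k l) / normA E) => [|N AN]; first by rewrite divr_ge0 ?ltW.
pose t := op_norm (N k l) / op_norm (M k l).
have t0 : 0 <= t by rewrite divr_ge0 ?op_norm_ge0.
have [_ ] : A (t%:C%C *: E) /\ normA (t%:C%C *: E) <= normA N.
  apply: solid => // i j.
  rewrite -[(t%:C%C *: E) i j]/(t%:C%C *: E i j) /E.
  case: ifP => [/andP[/eqP-> /eqP->]|_]; last first.
    by rewrite scaler0 op_norm0 op_norm_ge0.
  by rewrite (le_trans (op_normZ_le _ _))// divfK ?gt_eqF.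
rewrite (bsa_normZ bA)// normc_def /= expr0n/= addr0 sqrtr_sqr ger0_norm// => h.
by rewrite mulrAC ler_pdivlMr// -ler_pdivrMl// mulrA (mulrC _^-1).
Qed.

End SpectralAlgebra.

(** * Action, product and inversion of the matrices [c + C L C^*] *)

Section FrameMatrices.
Context {R : realType} {H : hilbertType R} {X : countType}.
Variables (T : X -> bounded_op H) (b : R).
Hypothesis b0 : 0 < b.
Hypothesis upper : forall x, (sqsum (fun k => T k x) <= (b * rnorm x ^+ 2)%:E)%E.
Implicit Types (c : R[i]) (L M : bounded_op H) (f : X -> H) (x y : H).

(* The matrix of [c + C L C^*], where [C x = (T k x)_k] is the analysis operator. *)
Definition frame_mx c L : opmatrix H X :=
  fun k j => c *: opmx_one k j + op_comp (T k) (op_comp L (op_adj (T j))).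

Local Notation S := (gframe_op T).
Local Notation D := (synthesis T).

(** Sums [|u + v|^2 <= 2 (|u|^2 + |v|^2)] over finite sets. Families [c f + C x] are what [frame_mx]
    produces, so this makes repeated action possible. *)
Lemma l2_affine c f x : l2 f -> l2 (fun k => c *: f k + T k x) /\
  l2norm (fun k => c *: f k + T k x) <=
  Num.sqrt (2 * (complex.Re `|c| ^+ 2 * l2norm f ^+ 2 + b * rnorm x ^+ 2)).
Proof.
move=> f2; apply: l2_bounded_fset; last exact: sqrtr_ge0.
move=> J; rewrite sqr_sqrtr; last first.
  by rewrite mulr_ge0 ?addr_ge0// mulr_ge0 ?sqr_ge0 ?(ltW b0).
have : \sum_(k <- J) rnorm (c *: f k + T k x) ^+ 2 <= \sum_(k <- J)
    (2 * (complex.Re `|c| ^+ 2 * rnorm (f k) ^+ 2 + rnorm (T k x) ^+ 2)).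
  apply: ler_sum => k _; rewrite -exprMn -rnormZ rnorm_sqrD.
  by have := @ip_young _ _ 1 (c *: f k) (T k x) ltr01; rewrite invr1; lra.
move=> /le_trans; apply; rewrite -mulr_sumr ler_pM2l// big_split/= -mulr_sumr.
by rewrite lerD ?(analysis_fset upper)// ler_wpM2l ?sqr_ge0 ?l2_fset.
Qed.

Lemma synthesis_affine c f x : l2 f ->
  D (fun k => c *: f k + T k x) = c *: D f + S x.
Proof.
move=> f2; apply: has_hsum_hsum.
have := has_hsumD (has_hsumZ c (has_hsum_synthesis b0 upper f2))
  (has_hsum_frame b0 upper x).
by under eq_fun do rewrite -linearZ -linearD.
Qed.

Lemma has_hsum_frame_mx c L f k : l2 f ->
  has_hsum (fun j => frame_mx c L k j (f j)) (c *: f k + T k (L (D f))).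
Proof.
move=> f2.
have := has_hsumD (has_hsumZ c (has_hsum_single k (f k)))
  (has_hsum_op (op_comp (T k) L) (has_hsum_synthesis b0 upper f2)).
congr has_hsum; apply/funext => j.
rewrite /frame_mx opD opZ /opmx_one; congr (_ *: _ + _).
by case: eqP => [<-|].
Qed.

Arguments has_hsum_frame_mx : clear implicits.

Lemma opmx_act_frame_mx c L f : l2 f ->
  opmx_act (frame_mx c L) f = fun k => c *: f k + T k (L (D f)).
Proof. by move=> f2; apply/funext => k; exact/has_hsum_hsum/has_hsum_frame_mx. Qed.

Lemma frame_mx_bounded c L : l2_bounded (frame_mx c L).
Proof.
split=> [f k f2|]; first exact: (has_hsum_hsummable (has_hsum_frame_mx c L f k f2)).
have [r r0 Lr] := bounded_op_rnorm L.
pose K := 2 * (complex.Re `|c| ^+ 2 + b * (r ^+ 2 * b)).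
exists (Num.sqrt K) => f f2; rewrite (opmx_act_frame_mx _ _ f2).
have [g2 gn] := l2_affine c (L (D f)) f2; split=> //.
rewrite (le_trans gn)//.
have K0 : 0 <= K by rewrite mulr_ge0 ?addr_ge0 ?sqr_ge0// !mulr_ge0 ?sqr_ge0 ?(ltW b0).
have -> : Num.sqrt K * l2norm f = Num.sqrt (K * l2norm f ^+ 2).
  by rewrite sqrtrM// sqrtr_sqr ger0_norm ?sqrtr_ge0.
have -> : K * l2norm f ^+ 2 =
    2 * (complex.Re `|c| ^+ 2 * l2norm f ^+ 2 + b * (r ^+ 2 * (b * l2norm f ^+ 2))).
  by rewrite /K; ring.
apply: ler_wsqrtr; rewrite ler_pM2l// lerD2l ler_pM2l//.
have := Lr (D f); have := synthesis_bound b0 upper f2.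
move=> h1 h2; have h3 := le_trans h2 (ler_wpM2l r0 h1).
have s0 := sqrtr_ge0 b; have l0 : 0 <= l2norm f by exact: sqrtr_ge0.
rewrite -[b in leRHS]sqr_sqrtr ?(ltW b0)// -!exprMn ler_sqr ?nnegrE ?rnorm_ge0//.
by rewrite !mulr_ge0.
Qed.

(** Since [S = C^* C], the product of [c + C L C^*] and [d + C M C^*] is
    [c d + C (d L + c M + L S M) C^*]; inversion of matrices thus reduces to identities on [H]. *)
Lemma frame_mx_inverse c L d M : c * d = 1 ->
  (forall x, d *: L x + c *: M x + M (S (L x)) = 0) ->
  (forall x, d *: L x + c *: M x + L (S (M x)) = 0) ->
  l2_inverse (frame_mx c L) (frame_mx d M).
Proof.
move=> cd ML LM; split; first exact: frame_mx_bounded.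
move=> f f2; have [g2 _] := l2_affine c (L (D f)) f2.
have [h2 _] := l2_affine d (M (D f)) f2.
rewrite (opmx_act_frame_mx _ _ f2) (opmx_act_frame_mx _ _ g2).
rewrite (opmx_act_frame_mx _ _ f2) (opmx_act_frame_mx _ _ h2).
rewrite !synthesis_affine//; split; apply/funext => k.
- rewrite scalerDr scalerA (mulrC d) cd scale1r -addrA -op_appZ -op_appD.
  by rewrite [M (_ + _)]op_appD [M (_ *: _)]op_appZ addrA ML op_app0 addr0.
- rewrite scalerDr scalerA cd scale1r -addrA -op_appZ -op_appD.
  rewrite [L (_ + _)]op_appD [L (_ *: _)]op_appZ addrA.
  by rewrite (addrC (c *: _)) LM op_app0 addr0.
Qed.

Lemma opmx_mul_frame_mx c L d M :
  opmx_mul (frame_mx c L) (frame_mx d M) =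
  frame_mx (c * d) (c *: M + d *: L + op_comp L (op_comp S M)).
Proof.
apply/funext => k; apply/funext => j; apply: val_inj.
set N := frame_mx _ _ k j.
(* Identifying the sum with the bounded operator [N] rules out the default of [insubd] in
   [opmx_mul]. *)
suff NE : (fun x => hsum (fun m => frame_mx c L k m (frame_mx d M m j x))) = N.
  rewrite /opmx_mul NE -[bounded_op_fun N]/(val N).
  by rewrite insubdK//; exact: (bounded_opP N).
apply/funext => x; apply: has_hsum_hsum.
(* Column [j] of the second factor at [x] is its action on the family [e] supported at [j], so the
   sum over [m] is an action of the first factor on an [l2] family. *)
pose e i : H := if j == i then x else 0.
have e2 : l2 e.
  apply: (@l2_bounded_fset _ _ _ e (rnorm x) _ (rnorm_ge0 _)).1 => J.
  have [jJ|jJ] := boolP (j \in J).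
    rewrite (big_fsetD1 j)//= big1_fset ?addr0 /e ?eqxx// => i.
    by rewrite in_fsetD1 eq_sym => /andP[/negPf->]; rewrite rnorm0 expr0n.
  rewrite big1_fset ?sqr_ge0// => i iJ _; rewrite /e; case: eqP => [ji|_].
    by rewrite ji iJ in jJ.
  by rewrite rnorm0 expr0n.
have De : D e = op_adj (T j) x.
  apply: has_hsum_hsum; have := has_hsum_single j (op_adj (T j) x).
  congr has_hsum; apply/funext => i; rewrite /e.
  by case: eqP => [->//|_]; rewrite linear0.
have eE : (fun i => frame_mx d M i j x) =
    fun i => d *: e i + T i (M (op_adj (T j) x)).
  apply/funext => i; rewrite /frame_mx opD opZ; congr (_ *: _ + _).
  by rewrite /opmx_one /e eq_sym; case: eqP.
have [g2 _] := l2_affine d (M (op_adj (T j) x)) e2.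
have := has_hsum_frame_mx c L _ k g2; rewrite synthesis_affine// De.
under eq_fun do rewrite -[_ + T _ _]/((fun i => d *: e i + T i (M (op_adj (T j) x))) _) -eE.
congr has_hsum.
set z := op_adj (T j) x.
have -> : N x = (c * d) *: opmx_one k j x +
  T k (c *: M z + d *: L z + L (S (M z))) by [].
rewrite scalerDr scalerA -addrA; congr (_ *: _ + _).
  by rewrite /opmx_one /e eq_sym; case: eqP.
rewrite -op_appZ -op_appD; congr (T k _).
by rewrite [L (_ + _)]op_appD [L (_ *: _)]op_appZ addrA.
Qed.

End FrameMatrices.

(** * Iterated means over square roots on the unit circle *)

Section Circle.
Context {R : realType}.
Implicit Types (w v z s : R[i]).

Definition cnorm z : R := complex.Re `|z|.

Lemma cnormE z : `|z| = (cnorm z)%:C%C.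
Proof. by rewrite /cnorm RRe_real// normr_real. Qed.

Lemma cnorm_ge0 z : 0 <= cnorm z.
Proof. by rewrite -ler0c -cnormE. Qed.

Lemma cnormM w v : cnorm (w * v) = cnorm w * cnorm v.
Proof. by apply: (@complexI R); rewrite rmorphM/= -!cnormE normrM. Qed.

Lemma cnormN z : cnorm (- z) = cnorm z.
Proof. by rewrite /cnorm normrN. Qed.

Lemma cnorm1 : cnorm 1 = 1.
Proof. by rewrite /cnorm normr1. Qed.

Lemma cnorm_real (c : R) : cnorm c%:C%C = `|c|.
Proof. by rewrite /cnorm normc_def/= expr0n/= addr0 sqrtr_sqr. Qed.

Lemma cnorm_conj z : cnorm (Num.conj z) = cnorm z.
Proof. by rewrite /cnorm norm_conjC. Qed.

Lemma cnorm_sqr z : cnorm z ^+ 2 = complex.Re z ^+ 2 + complex.Im z ^+ 2.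
Proof. by apply: (@complexI R); rewrite rmorphXn/= -cnormE add_Re2_Im2. Qed.

Lemma cnorm_le_ReIm z : cnorm z <= `|complex.Re z| + `|complex.Im z|.
Proof.
rewrite -ler_sqr ?nnegrE ?cnorm_ge0 ?addr_ge0//.
rewrite cnorm_sqr -(real_normK (num_real (complex.Re z))).
rewrite -(real_normK (num_real (complex.Im z))) sqrrD.
by rewrite lerD2r lerDl mulrn_wge0// mulr_ge0.
Qed.

Lemma conj_unit w : cnorm w = 1 -> w * Num.conj w = 1.
Proof. by move=> w1; rewrite -normCK cnormE w1 expr1n. Qed.

(** Compactness of the circle enters through the extreme value theorem on [[-pi, pi]]; the angles
    [acos (Re w)] and [- acos (Re w)] reach the upper and lower half-circles. *)
Lemma circle_positive_min (g : R[i] -> R) (K : R) :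
  (forall w v, cnorm w = 1 -> cnorm v = 1 -> `|g w - g v| <= K * cnorm (w - v)) ->
  (forall w, cnorm w = 1 -> 0 < g w) ->
  exists2 d : R, 0 < d & forall w, cnorm w = 1 -> d <= g w.
Proof.
move=> gK g0; pose p (x : R) : R[i] := (cos x +i* sin x)%C.
have p1 x : cnorm (p x) = 1.
  apply/eqP; rewrite -(@eqrXn2 _ 2) ?cnorm_ge0// cnorm_sqr expr1n.
  by rewrite /= cos2Dsin2.
have gpC : continuous (g \o p).
  move=> x; apply/cvgrPdist_lt => e e0.
  have K0 : 0 < `|K| + 1 by rewrite ltr_wpDl.
  have d0 : 0 < e / (`|K| + 1) / 2 by rewrite !divr_gt0.
  have /cvgrPdist_lt/(_ _ d0) hc := @continuous_cos R x.
  have /cvgrPdist_lt/(_ _ d0) hs := @continuous_sin R x.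
  near=> y; rewrite /= (le_lt_trans (gK _ _ (p1 _) (p1 _)))//.
  have h : cnorm (p x - p y) < e / (`|K| + 1).
    rewrite (le_lt_trans (cnorm_le_ReIm _))//= [ltRHS]splitr ltrD//.
      by near: y.
    by near: y.
  move: h; rewrite ltr_pdivlMr//; have := cnorm_ge0 (p x - p y).
  have := ler_norm K; move: (cnorm _) => q; nra.
have piN : - pi <= pi :> R by have := @pi_ge0 R; lra.
have [x _ xP] := EVT_min piN (continuous_subspaceT gpC).
exists (g (p x)); first exact: g0.
move=> w w1; have ww : complex.Re w ^+ 2 + complex.Im w ^+ 2 = 1.
  by rewrite -cnorm_sqr w1 expr1n.
have w11 : -1 <= complex.Re w <= 1.
  have := sqr_ge0 (complex.Im w); move: (complex.Re w) (complex.Im w) ww.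
  move=> ? ? ? ?; rewrite -ler_norml -(@ler_sqr R) ?nnegrE//.
  by rewrite real_normK ?num_real//; lra.
have acP : - pi <= acos (complex.Re w) <= pi.
  by rewrite acos_lepi// andbT (le_trans _ (acos_ge0 _))// oppr_le0 pi_ge0.
have sinP : sin (acos (complex.Re w)) = `|complex.Im w|.
  by rewrite sin_acos// -ww addrAC subrr add0r sqrtr_sqr.
have [i0|i0] := leP 0 (complex.Im w).
  have -> : w = p (acos (complex.Re w)).
    by rewrite /p acosK ?in_itv// sinP ger0_norm//; case: (w).
  exact: xP.
have -> : w = p (- acos (complex.Re w)).
  by rewrite /p cosN sinN acosK ?in_itv// sinP ltr0_norm// opprK; case: (w).
apply: xP; rewrite in_itv/=; move/andP: acP => [h1 h2].
by apply/andP; split; lra.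
Unshelve. all: by end_near. Qed.

(** * Means over the two square roots *)

Section Averaging.
Context {V : lmodType R[i]}.
Implicit Types F : R[i] -> V.

Definition sqrt_mean F w : V := 2^-1 *: (F (sqrtC w) + F (- sqrtC w)).

(** The mean is independent of the branch: [sqrtC (s ^+ 2)] is [s] or [- s], and the mean is
    symmetric in the two. *)
Lemma sqrt_mean_sqr F s : sqrt_mean F (s ^+ 2) = 2^-1 *: (F s + F (- s)).
Proof.
rewrite /sqrt_mean; have /eqP := sqrtCK (s ^+ 2).
by rewrite eqf_sqr => /orP[/eqP->//|/eqP->]; rewrite opprK addrC.
Qed.

Variables (A : set V) (N : V -> R).
Hypothesis A_lin : forall c x y, A x -> A y -> A (c *: x + y).
Hypothesis NZ : forall c x, A x -> N (c *: x) = cnorm c * N x.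
Hypothesis ND : forall x y, A x -> A y -> N (x + y) <= N x + N y.

Definition circle_lip (K : R) F := forall w v, cnorm w = 1 -> cnorm v = 1 ->
  N (F w - F v) <= K * cnorm (w - v).

Definition circle_in F := forall w, cnorm w = 1 -> A (F w).

Let A_add x y : A x -> A y -> A (x + y).
Proof. by move=> Ax Ay; rewrite -[x]scale1r; exact: A_lin. Qed.

Let A_sub x y : A x -> A y -> A (x - y).
Proof. by move=> Ax Ay; rewrite addrC -scaleN1r; exact: A_lin. Qed.

Let A_scale c x : A x -> A (c *: x).
Proof.
move=> Ax; rewrite -[_ *: _]addr0 -(subrr x).
by apply: A_lin => //; exact: A_sub.
Qed.

Lemma cnorm_sqrt s w : s ^+ 2 = w -> cnorm w = 1 -> cnorm s = 1.
Proof.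
move=> <-; rewrite expr2 cnormM -expr2 => /eqP.
by rewrite -[X in _ == X](expr1n _ 2) eqrXn2 ?cnorm_ge0// => /eqP.
Qed.

Lemma cnorm_half : cnorm 2^-1 = 2^-1.
Proof.
have -> : (2^-1 : R[i]) = (2^-1 : R)%:C%C by rewrite fmorphV/= rmorph_nat.
by rewrite cnorm_real ger0_norm ?invr_ge0.
Qed.

Lemma sqrt_mean_in F : circle_in F -> circle_in (sqrt_mean F).
Proof.
move=> AF w w1; have s1 := cnorm_sqrt (sqrtCK w) w1.
by apply/A_scale/A_add; apply: AF; rewrite ?cnormN.
Qed.

(* Choosing the square roots with [|s - t| <= |s + t|] gives [|s + t| >= sqrt 2],
   hence [|w - v| = |s - t| |s + t| >= (7/5) |s - t|]. *)
Lemma sqrt_mean_lip F (K : R) : 0 <= K -> circle_in F -> circle_lip K F ->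
  circle_lip (K * (5 / 7)) (sqrt_mean F).
Proof.
move=> K0 AF FK w v w1 v1; pose s := sqrtC w.
have s2 : s ^+ 2 = w by exact: sqrtCK.
have s1 := cnorm_sqrt s2 w1.
have [t t2 st] : exists2 t, t ^+ 2 = v & cnorm (s - t) <= cnorm (s + t).
  have [h|/ltW h] := leP (cnorm (s - sqrtC v)) (cnorm (s + sqrtC v)).
    by exists (sqrtC v) => //; exact: sqrtCK.
  by exists (- sqrtC v); rewrite ?sqrrN ?sqrtCK ?opprK.
have t1 := cnorm_sqrt t2 v1.
have par : cnorm (s - t) ^+ 2 + cnorm (s + t) ^+ 2 = 4.
  have := cnorm_sqr s; have := cnorm_sqr t; rewrite s1 t1 !cnorm_sqr.
  by case: (s) => ? ?; case: (t) => ? ? /=; lra.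
(* By [par] the larger of the two squares is at least [2], and [7 / 5] is a rational number below
   [sqrt 2]. *)
have st75 : 7 / 5 <= cnorm (s + t).
  rewrite -ler_sqr ?nnegrE ?cnorm_ge0 ?divr_ge0//.
  have : cnorm (s - t) ^+ 2 <= cnorm (s + t) ^+ 2.
    by rewrite ler_sqr ?nnegrE ?cnorm_ge0.
  have h : (7 / 5 : R) ^+ 2 <= 2 by lra.
  by lra.
have wv : cnorm (w - v) = cnorm (s - t) * cnorm (s + t).
  by rewrite -s2 -t2 subr_sqr cnormM.
rewrite -{1}s2 -{1}t2 !sqrt_mean_sqr -scalerBr opprD addrACA.
have As : A (F s) by exact: AF.
have At : A (F t) by exact: AF.
have As' : A (F (- s)) by apply: AF; rewrite cnormN.
have At' : A (F (- t)) by apply: AF; rewrite cnormN.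
rewrite NZ; last by apply: A_add; exact: A_sub.
rewrite cnorm_half (le_trans (ler_wpM2l _ (ND (A_sub As At) (A_sub As' At'))))//.
have h1 := FK _ _ s1 t1.
have := FK (- s) (- t); rewrite !cnormN -opprD cnormN => /(_ s1 t1) h2.
have : K * cnorm (s - t) <= K * (5 / 7) * cnorm (w - v).
  rewrite -mulrA ler_wpM2l// wv; have := cnorm_ge0 (s - t).
  by move: (cnorm _) (cnorm (s + t)) st75 => ? ? ? ?; nra.
by lra.
Qed.

Lemma iter_sqrt_mean F (K : R) m : 0 <= K -> circle_in F -> circle_lip K F ->
  circle_in (iter m sqrt_mean F) /\
  circle_lip (K * (5 / 7) ^+ m) (iter m sqrt_mean F).
Proof.
move=> K0 AF FK; elim: m => [|m [IHA IHK]]; first by rewrite mulr1.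
split; first exact: sqrt_mean_in.
rewrite exprSr [K * _]mulrA iterS; refine (@sqrt_mean_lip _ _ _ IHA IHK).
by rewrite mulr_ge0// exprn_ge0// divr_ge0.
Qed.

(** The square roots of [1] are [1] and [-1], so consecutive terms differ by half the increment of
    the [m]-th mean between these points, at distance [2]. The Lipschitz constants decay
    geometrically. *)
Lemma iter_sqrt_mean_cauchy F (K : R) : 0 <= K -> circle_in F ->
  circle_lip K F -> forall e, 0 < e -> exists n0 : nat, forall m n : nat,
    (n0 <= m)%N -> (n0 <= n)%N ->
    N (iter m sqrt_mean F 1 - iter n sqrt_mean F 1) < e.
Proof.
move=> K0 AF FK; pose u m := iter m sqrt_mean F 1.
have Au m : A (u m) by apply: (iter_sqrt_mean m K0 AF FK).1; exact: cnorm1.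
have NN x : A x -> N (- x) = N x.
  by move=> Ax; rewrite -scaleN1r NZ// cnormN cnorm1 mul1r.
apply: (@geometric_cauchy R (fun m n => N (u m - u n)) K (5 / 7)) => //.
- by lra.
- by move=> n; rewrite subrr -(scale0r (u 0%N)) NZ// /cnorm normr0 mul0r.
- by move=> m n; rewrite -NN ?opprB//; exact: A_sub.
- move=> m n p; have -> : u m - u p = (u m - u n) + (u n - u p).
    by rewrite addrA subrK.
  by apply: ND; exact: A_sub.
move=> m; have [IHA IHK] := iter_sqrt_mean m K0 AF FK.
have -> : u m.+1 - u m = 2^-1 *: (iter m sqrt_mean F (-1) - iter m sqrt_mean F 1).
  rewrite /u iterS -[X in sqrt_mean _ X](expr1n _ 2) sqrt_mean_sqr.
  set P := iter m _ F 1; have {2}-> : P = 2^-1 *: (P + P).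
    by rewrite scalerDr -scalerDl -[P in LHS]scale1r; congr (_ *: _); field.
  by rewrite -scalerBr opprD addrACA subrr add0r.
have N1 : cnorm (-1) = 1 by rewrite cnormN cnorm1.
have A1 := IHA _ cnorm1; have AN1 := IHA _ N1.
rewrite NZ ?cnorm_half; last exact: A_sub.
have := IHK _ _ N1 cnorm1.
have -> : cnorm (- 1 - 1) = 2.
  rewrite -opprD cnormN -[1 + 1]/(2%:R) -[2%:R](rmorph_nat (real_complex R)).
  by rewrite cnorm_real ger0_norm.
by lra.
Qed.

End Averaging.

End Circle.

(** The mean of [(1 - s t)^-1] and [(1 + s t)^-1] is [(1 - s^2 t^2)^-1]. Hence the [m]-th mean of
    [(1 - w t)^-1] is [(1 - w t^(2^m))^-1], which tends to the identity. *)
Lemma iter_sqrt_mean_neumann {R : realType} {H : hilbertType R}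
    (t : bounded_op H) (U : R[i] -> bounded_op H) :
  (forall x, rnorm (t x) <= 2^-1 * rnorm x) ->
  (forall w, cnorm w = 1 -> forall x, U w x - w *: t (U w x) = x) ->
  (forall w, cnorm w = 1 -> forall x, rnorm (U w x) <= 2 * rnorm x) ->
  forall m w, cnorm w = 1 -> forall x,
    rnorm (iter m sqrt_mean U w x - x) <= 2^-1 ^+ m * rnorm x.
Proof.
move=> t2 Ut U2; pose tau m := iter m (fun s => op_comp s s) t.
(* [tau m] is [t^(2^m)]; this crude bound on its norm suffices. *)
have tau_le m x : rnorm (tau m x) <= 2^-1 ^+ m.+1 * rnorm x.
  elim: m x => [|m IH] x; first by rewrite expr1 t2.
  rewrite -[tau m.+1 x]/(tau m (tau m x)) (le_trans (IH _))//.
  rewrite (le_trans (ler_wpM2l _ (IH _))) ?exprn_ge0// mulrA ler_wpM2r ?rnorm_ge0//.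
  rewrite [leRHS]exprSr ler_wpM2l ?exprn_ge0// exprS ler_piMr//.
  by rewrite exprn_ile1//; lra.
(* The resolvent equation and the bound [2] are propagated together; the equation then writes the
   distance to [x] as [|tau m|] applied to a vector of norm at most [2 |x|]. *)
suff main m w : cnorm w = 1 -> forall x,
    iter m sqrt_mean U w x - w *: tau m (iter m sqrt_mean U w x) = x /\
    rnorm (iter m sqrt_mean U w x) <= 2 * rnorm x.
  move=> m w w1 x; have [e1 e2] := main m w w1 x.
  rewrite -{2}e1 opprB addrC subrK rnormZ -/(cnorm w) w1 mul1r.
  rewrite (le_trans (tau_le _ _))// exprSr -mulrA ler_wpM2l ?exprn_ge0//.
  by rewrite ler_pdivrMl.
elim: m w => [|m IH] w w1 x; first by split; [exact: Ut|exact: U2].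
pose s := sqrtC w; have s2 : s ^+ 2 = w by exact: sqrtCK.
have s1 := cnorm_sqrt s2 w1; have Ns1 : cnorm (- s) = 1 by rewrite cnormN.
have [e1 e2] := IH _ s1 x; have [f1 f2] := IH _ Ns1 x.
rewrite iterS -s2 sqrt_mean_sqr opZ opD.
move: e1 e2 f1 f2; set p := iter m _ U s x; set q := iter m _ U (- s) x.
rewrite scaleNr opprK => e1 e2 f1 f2.
have e3 : s *: tau m p = p - x by rewrite -[in RHS]e1 subKr.
have f3 : s *: tau m q = x - q by rewrite -[in RHS]f1 addrC addKr.
split; last first.
  rewrite rnormZ -/(cnorm _) cnorm_half ler_pdivrMl//.
  by rewrite (le_trans (rnormD _ _))//; lra.
have hZ y : s *: tau m (2^-1 *: y) = 2^-1 *: (s *: tau m y).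
  by rewrite op_appZ !scalerA mulrC.
(* With [r = (p + q) / 2], the relations [e3] and [f3] give [s tau r = (p - q) / 2], and a second
   application gives [r - x]. *)
rewrite -[tau m.+1 _]/(tau m (tau m _)) expr2 -scalerA -op_appZ hZ hZ.
rewrite [tau m (p + q)]op_appD [s *: (_ + _)]scalerDr e3 f3 addrA subrK.
rewrite [tau m (p - q)]op_appB scalerBr e3 f3 -scalerBr.
rewrite !opprB [p + q]addrC addrACA !(addrCA _ x) !subrr !addr0.
by rewrite scalerDr -scalerDl (_ : 2^-1 + 2^-1 = 1) ?scale1r//; field.
Qed.

(** * Membership of the dual Gram matrices in the spectral algebra *)

Section FrameMatrixAlgebra.
Context {R : realType} {H : hilbertType R} {X : countType}.
Variables (T : X -> bounded_op H).
Implicit Types (c d : R[i]) (L M : bounded_op H).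

Lemma frame_mxD c d L M :
  frame_mx T c L + frame_mx T d M = frame_mx T (c + d) (L + M).
Proof.
apply/funext => k; apply/funext => j; apply: bounded_op_eq => x.
set y := op_adj (T j) x.
have -> : (frame_mx T c L + frame_mx T d M) k j x =
  (c *: opmx_one k j x + T k (L y)) + (d *: opmx_one k j x + T k (M y)) by [].
have -> : frame_mx T (c + d) (L + M) k j x =
  (c + d) *: opmx_one k j x + T k (L y + M y) by [].
by rewrite op_appD scalerDl addrACA.
Qed.

Lemma frame_mxZ c d L : c *: frame_mx T d L = frame_mx T (c * d) (c *: L).
Proof.
apply/funext => k; apply/funext => j; apply: bounded_op_eq => x.
set y := op_adj (T j) x.
have -> : (c *: frame_mx T d L) k j x = c *: (d *: opmx_one k j x + T k (L y)).
  by [].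
have -> : frame_mx T (c * d) (c *: L) k j x =
  (c * d) *: opmx_one k j x + T k (c *: L y) by [].
by rewrite op_appZ scalerDr scalerA.
Qed.

Lemma frame_mxB c d L M :
  frame_mx T c L - frame_mx T d M = frame_mx T (c - d) (L - M).
Proof. by rewrite -scaleN1r frame_mxZ frame_mxD mulN1r scaleN1r. Qed.

Lemma frame_mx_gram : frame_mx T 0 (op_id H) = gram T T.
Proof.
apply/funext => k; apply/funext => j; apply: bounded_op_eq => x.
by rewrite /frame_mx opD opZ scale0r add0r.
Qed.

Lemma frame_mx_one : frame_mx T 1 0 = opmx_one.
Proof.
apply/funext => k; apply/funext => j; apply: bounded_op_eq => x.
by rewrite /frame_mx opD opZ scale1r /= op_app0 addr0.
Qed.

End FrameMatrixAlgebra.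

(** * The Gram resolvent, the range projection and the pseudo-inverse *)

Section Localization.
Context {R : realType} {H : hilbertType R} {X : countType}.
Variables (A : set (opmatrix H X)) (normA : opmatrix H X -> R).
Variables (T : X -> bounded_op H) (W : bounded_op H) (a b : R).
Hypothesis spA : spectral_algebra A normA.
Hypotheses (a0 : 0 < a) (b0 : 0 < b).
Hypothesis upper : forall x, (sqsum (fun k => T k x) <= (b * rnorm x ^+ 2)%:E)%E.
Hypotheses (SW : cancel (gframe_op T) W) (WS : cancel W (gframe_op T)).
Hypothesis W_le : forall x, a * rnorm (W x) <= rnorm x.
Hypothesis AG : A (gram T T).

Local Notation S := (gframe_op T).
Let bA : banach_star_algebra A normA := spa_banach spA.
Let c : R[i] := (2 / a)%:C%C.
(** This is [(c S)^-1]; the factor [2 / a] in [c] gives it norm at most [1 / 2], so [1 - w t] is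
    invertible by a Neumann series for all [w] on the circle. *)
Let t : bounded_op H := (a / 2)%:C%C *: W.

Let ct : c * (a / 2)%:C%C = 1.
Proof.
rewrite -rmorphM/= -(rmorph1 (real_complex R)); congr _%:C%C.
by field; rewrite gt_eqF.
Qed.

Let tE x : c *: t x = W x.
Proof. by rewrite opZ scalerA ct scale1r. Qed.

Let t_le x : rnorm (t x) <= 2^-1 * rnorm x.
Proof.
rewrite opZ rnormZr gtr0_norm ?divr_gt0// mulrAC mulrC ler_wpM2l ?invr_ge0//.
Qed.

Let resolvent_exists : exists U : R[i] -> bounded_op H, forall w, cnorm w = 1 ->
  [/\ forall x, U w x - w *: t (U w x) = x, forall x, U w (x - w *: t x) = x &
      forall x, rnorm (U w x) <= 2 * rnorm x].
Proof.
(* [choice] asks for an operator at every [w]; off the circle [0] is supplied. *)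
suff /choice[U UP] : forall w, exists V : bounded_op H, cnorm w = 1 ->
  [/\ forall x, V x - w *: t (V x) = x, forall x, V (x - w *: t x) = x &
      forall x, rnorm (V x) <= 2 * rnorm x] by exists U.
move=> w; have [w1|w1] := pselect (cnorm w = 1); last by exists 0.
have [|||V [V1 V2 V3]] := @neumann_inverse _ _ (w *: t) (2^-1 : R).
- by rewrite invr_ge0.
- by lra.
- by move=> x; rewrite -[(w *: t) x]/(w *: t x) rnormZ -/(cnorm w) w1 mul1r; exact: t_le.
exists V => _; split=> // x; rewrite (le_trans (V3 x))//.
by rewrite (_ : 1 - 2^-1 = 2^-1) ?invrK//; lra.
Qed.

(* The resolvent [(1 - c w^* G)^-1] of the Gram matrix [G] on the unit circle. *)
Let B (U : R[i] -> bounded_op H) w := frame_mx T 1 (- op_comp W (U w)).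

Section Resolvent.
Variable U : R[i] -> bounded_op H.
Hypothesis UP : forall w, cnorm w = 1 ->
  [/\ forall x, U w x - w *: t (U w x) = x, forall x, U w (x - w *: t x) = x &
      forall x, rnorm (U w x) <= 2 * rnorm x].

(** Inverse-closedness is applied to [P = 1 - c w^* G]. On [H] the inversion rests on
    [1 - c w^* S = - c w^* S (1 - w t)], where [w^* w = 1] and [c t = W]. *)
Let B_in : circle_in A (B U).
Proof.
move=> w w1; have [U1 U2 _] := UP w1; have ww := conj_unit w1.
set w' := Num.conj w in ww.
pose P := frame_mx T 1 (- (c * w') *: op_id H).
have AP : A P.
  have -> : P = - (c * w') *: gram T T + opmx_one.
    by rewrite -frame_mx_gram -(frame_mx_one T) frame_mxZ frame_mxD mulr0 add0r addr0.
  by apply: (bsa_lin bA) => //; exact: (bsa_one bA).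
apply: (spa_inverse_closed spA AP); apply: (frame_mx_inverse b0 upper).
- by rewrite mulr1.
- move=> x; rewrite !scale1r.
  have Wc y : W (c *: S y) = c *: y by rewrite op_appZ SW.
  have h : U w (S ((c * w') *: x)) = w' *: (c *: S x) + U w x.
    have tcS : t (c *: S x) = x by rewrite opZ Wc scalerA mulrC ct scale1r.
    have e : U w (c *: S x) = c *: S x + w *: U w x.
      have := U2 (c *: S x); rewrite tcS op_appB [U w (w *: _)]op_appZ.
      by move=> /eqP; rewrite subr_eq => /eqP.
    have -> : S ((c * w') *: x) = w' *: (c *: S x).
      by rewrite op_appZ scalerA mulrC.
    by rewrite op_appZ e scalerDr [w' *: (w *: _)]scalerA (mulrC w') ww scale1r.
  rewrite -[(- _ *: op_id H) x]/(- (c * w') *: x).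
  rewrite -[(- op_comp W (U w)) x]/(- W (U w x)).
  rewrite -[(- op_comp W (U w)) _]/(- W (U w _)).
  rewrite !scaleNr [S _]op_appN [U w (- _)]op_appN [W (- _)]op_appN opprK h.
  rewrite op_appD [W (w' *: _)]op_appZ Wc scalerA (mulrC w').
  by rewrite -opprD addNr.
- move=> x; rewrite !scale1r.
  rewrite -[(- op_comp W (U w)) x]/(- W (U w x)).
  rewrite -[(- _ *: op_id H) x]/(- (c * w') *: x).
  rewrite -[(- _ *: op_id H) (S _)]/(- (c * w') *: S _).
  have e : (c * w') *: x = (c * w') *: U w x - c *: t (U w x).
    by rewrite -[in LHS](U1 x) scalerBr [_ *: (w *: _)]scalerA -mulrA (mulrC w') ww mulr1.
  rewrite [S _]op_appN WS !scaleNr scalerN opprK -opprD addrC e tE subrK.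
  exact: subrr.
Qed.

(** This is the resolvent identity for [1 - c w^* G], checked on the operators inside the frame
    matrices. *)
Let B_resolvent w v : cnorm w = 1 -> cnorm v = 1 ->
  B U w - B U v = ((Num.conj w - Num.conj v) * c) *:
    opmx_mul (gram T T) (opmx_mul (B U w) (B U v)).
Proof.
move=> w1 v1; rewrite -frame_mx_gram /B !(opmx_mul_frame_mx b0 upper).
rewrite frame_mxB frame_mxZ subrr mul0r mulr0; congr frame_mx.
apply: bounded_op_eq => x; have [Uw1 Uw2 _] := UP w1; have [Uv1 Uv2 _] := UP v1.
set w' := Num.conj w; set v' := Num.conj v.
(* Written through [h] and [k], both sides become multiples of [W (t k)]; the scalars agree because
   [w w^* = v v^* = 1]. *)
set h := U v x; set k := U w h.
have tW y : t y = (a / 2)%:C%C *: W y by [].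
have Utk : U w (t h) = t k.
  have -> : t h = t k - w *: t (t k).
    by rewrite -op_appZ -op_appB Uw1.
  by rewrite Uw2.
pose st := 1 *: - W h + 1 *: - W (U w x) + - W (U w (S (- W h))).
rewrite [LHS](_ : _ = - W (U w x) - - W h)//.
rewrite [RHS](_ : _ = ((w' - v') * c) *: (0 *: st + (1 * 1) *: x + S st))//.
have -> : S st = - h - U w x + k.
  rewrite /st !scale1r !op_appD ![S (- _)]op_appN !WS; congr (_ + _).
  by rewrite [U w (- _)]op_appN opprK.
have xE : x = h - v *: t h by rewrite Uv1.
have UwxE : U w x = k - v *: t k.
  by rewrite {1}xE [U w (_ - _)]op_appB [U w (_ *: _)]op_appZ Utk.
have kh : k - h = w *: t k by rewrite -[in LHS](Uw1 h) subKr.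
have xhk : - h - U w x + k + x = v *: (w *: t (t k)).
  rewrite UwxE {1}xE opprB -[- h + _ + k]addrA subrK addrACA addNr add0r.
  by rewrite -scalerBr -op_appB kh op_appZ.
have -> : - W (U w x) - - W h = (v - w) *: W (t k).
  rewrite opprK addrC -op_appB UwxE.
  have -> : h - (k - v *: t k) = v *: t k - (k - h) by rewrite !opprB addrCA.
  by rewrite kh -scalerBl op_appZ.
rewrite scale0r add0r mulr1 scale1r [x + _]addrC xhk -tE !scalerA.
congr (_ *: _); have ww := conj_unit w1; have vv := conj_unit v1.
rewrite -[v in LHS](mul1r v) -[w in LHS](mul1r w) -{1}ww -vv.
by rewrite -/w' -/v'; ring.
Qed.

Let beta w := normA (B U w).

Let beta_ge0 w : cnorm w = 1 -> 0 <= beta w.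
Proof. by move=> w1; exact: (bsa_norm_ge0 bA (B_in w1)). Qed.

Let normA_sub M N : A M -> A N -> `|normA M - normA N| <= normA (M - N).
Proof.
move=> AM AN; have AMN : A (M - N).
  by rewrite addrC -scaleN1r; exact: (bsa_lin bA).
have ANM : A (N - M) by rewrite addrC -scaleN1r; exact: (bsa_lin bA).
have e : normA (N - M) = normA (M - N).
  by rewrite -opprB -scaleN1r (bsa_normZ bA)// -/(cnorm _) cnormN cnorm1 mul1r.
have := bsa_normD bA AMN AN; have := bsa_normD bA ANM AM.
by rewrite !subrK e ler_norml; lra.
Qed.

Let K0 : R := 2 / a * normA (gram T T).

Let K0_ge0 : 0 <= K0.
Proof. by rewrite mulr_ge0 ?divr_ge0 ?(ltW a0)//; exact: (bsa_norm_ge0 bA AG). Qed.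

Let B_dist w v : cnorm w = 1 -> cnorm v = 1 ->
  normA (B U w - B U v) <= K0 * cnorm (w - v) * (beta w * beta v).
Proof.
move=> w1 v1; have Bw := B_in w1; have Bv := B_in v1.
have Bwv := bsa_mul bA Bw Bv; have GB := bsa_mul bA AG Bwv.
rewrite B_resolvent// (bsa_normZ bA)// -/(cnorm _) cnormM -rmorphB cnorm_conj.
rewrite cnorm_real ger0_norm ?divr_ge0 ?(ltW a0)//.
have h1 := bsa_normM bA AG Bwv; have h2 := bsa_normM bA Bw Bv.
have h3 := le_trans h1 (ler_wpM2l (bsa_norm_ge0 bA AG) h2).
have d0 : 0 <= cnorm (w - v) * (2 / a).
  by rewrite mulr_ge0 ?cnorm_ge0 ?divr_ge0 ?(ltW a0).
rewrite (le_trans (ler_wpM2l d0 h3))// /K0 -subr_ge0 [X in 0 <= X](_ : _ = 0)//.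
by rewrite /beta; ring.
Qed.

(* [1 / (beta + 1)] is Lipschitz by the resolvent identity. *)
Let B_bounded : exists2 C : R, 0 <= C & forall w, cnorm w = 1 -> beta w <= C.
Proof.
(* The shift by [1] makes the denominators positive and lets their product dominate the factor
   [beta w * beta v] of [B_dist]. *)
pose g w := (beta w + 1)^-1.
have b1 w : cnorm w = 1 -> 0 < beta w + 1.
  by move=> /beta_ge0; lra.
have [||d d0 gd] := @circle_positive_min R g K0.
- move=> w v w1 v1; have w2 := b1 w w1; have v2 := b1 v v1.
  have -> : g w - g v = (beta v - beta w) / ((beta w + 1) * (beta v + 1)).
    by rewrite /g; field; rewrite !gt_eqF.
  rewrite normrM normfV [X in _ / X]gtr0_norm ?mulr_gt0//.
  rewrite ler_pdivrMr ?mulr_gt0// distrC.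
  rewrite (le_trans (normA_sub (B_in w1) (B_in v1)))// (le_trans (B_dist w1 v1))//.
  rewrite (ler_wpM2l (mulr_ge0 K0_ge0 (cnorm_ge0 _)))//.
  by rewrite ler_pM ?beta_ge0// lerDl.
- by move=> w w1; rewrite invr_gt0 b1.
(* A positive lower bound of [g] is an upper bound of [beta]. *)
exists d^-1 => [|w w1]; first by rewrite invr_ge0 ltW.
have := gd w w1; rewrite /g -lef_pV2 ?posrE ?invr_gt0 ?b1// invrK.
by apply: le_trans; rewrite lerDl.
Qed.

(** Means commute with the affine map [L |-> 1 - C W L C^*]. *)
Let iter_B m w : iter m sqrt_mean (B U) w = B (iter m sqrt_mean U) w.
Proof.
elim: m w => // m IH w; rewrite !iterS {1}/sqrt_mean !IH /B frame_mxD frame_mxZ.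
apply: (congr2 (frame_mx T)).
  by rewrite -[1 + 1]/(2%:R) mulVf ?pnatr_eq0.
apply: bounded_op_eq => x.
set p := iter m _ U; set s := sqrtC w.
rewrite [LHS](_ : _ = 2^-1 *: (- W (p s x) + - W (p (- s) x)))//.
rewrite [RHS](_ : _ = - W (2^-1 *: (p s x + p (- s) x)))//.
by rewrite op_appZ op_appD -scalerN opprD.
Qed.

(** The iterated means at [1] converge in [A] to some [M], and each entry of [M] is then identified
    with that of [1 - C W C^*]. *)
Lemma projection_complement_in : A (frame_mx T 1 (- W)).
Proof.
have [C C0 BC] := B_bounded.
have KC0 : 0 <= K0 * C ^+ 2 by rewrite mulr_ge0 ?sqr_ge0.
have Blip : circle_lip normA (K0 * C ^+ 2) (B U).
  move=> w v w1 v1; rewrite (le_trans (B_dist w1 v1))// mulrAC.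
  rewrite ler_wpM2r ?cnorm_ge0// ler_wpM2l// expr2.
  by rewrite ler_pM ?beta_ge0 ?BC.
have ND := bsa_normD bA.
have um m : A (iter m sqrt_mean (B U) 1).
  exact: ((iter_sqrt_mean (bsa_lin bA) (bsa_normZ bA) ND m KC0 B_in Blip).1 _ cnorm1).
have [|M AM Mlim] := bsa_complete bA um.
  exact: (iter_sqrt_mean_cauchy (bsa_lin bA) (bsa_normZ bA) ND KC0 B_in Blip).
suff -> : frame_mx T 1 (- W) = M by [].
apply/funext => k; apply/funext => l; apply: bounded_op_eq => x.
apply/eqP; rewrite -subr_eq0; apply/eqP/rnorm_eq0/eqP.
rewrite eq_le rnorm_ge0 andbT; apply/ler_addgt0Pr => e e0; rewrite add0r.
have [K K_ge0 MK] := spectral_algebra_entry spA k l.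
have [r r0 Tr] := bounded_op_rnorm (op_comp (T k) W).
set y := op_adj (T l) x.
(* Error bound at entry [(k, l)] and vector [x]: the first term comes from convergence in [A],
   through solidity, the second from convergence of the means of [U] to the identity. *)
pose z m := K * rnorm x * normA (iter m sqrt_mean (B U) 1 - M) +
  r * rnorm y * 2^-1 ^+ m.
have z0 : z m @[m --> \oo] --> (0 : R).
  rewrite -[X in _ --> X](addr0 (0 : R)); apply: cvgD.
    by rewrite -[X in _ --> X](mulr0 (K * rnorm x)); apply: cvgMr.
  by apply: cvg_geometric; rewrite ger0_norm ?invr_ge0//; lra.
have /cvgrPdist_lt/(_ _ e0)[n _ nP] := z0.
have /= := nP n (leqnn n).
rewrite sub0r normrN => /(le_lt_trans (ler_norm _))/ltW.
apply: le_trans; rewrite /z iter_B; set F := B _ 1.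
have AF : A F by rewrite /F -iter_B.
have -> : frame_mx T 1 (- W) k l x - M k l x =
    (F - M) k l x + T k (W (iter n sqrt_mean U 1 y - y)).
  rewrite [(F - M) k l x](_ : _ = F k l x - M k l x)// [RHS]addrAC; congr (_ + _).
  rewrite [F k l x](_ : _ = 1 *: opmx_one k l x + T k (- W (iter n sqrt_mean U 1 y)))//.
  rewrite [LHS](_ : _ = 1 *: opmx_one k l x + T k (- W y))//.
  by rewrite -addrA -op_appD op_appB addKr.
rewrite (le_trans (rnormD _ _))// lerD//.
  rewrite (le_trans (op_norm_ub _ _))// mulrAC ler_wpM2r ?rnorm_ge0// MK//.
  by rewrite addrC -scaleN1r; apply: (bsa_lin bA).
rewrite (le_trans (Tr _))// -mulrA ler_wpM2l// mulrC.
apply: (@iter_sqrt_mean_neumann _ _ t) => //; last exact: cnorm1.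
- by move=> w /UP[].
- by move=> w /UP[].
Qed.

End Resolvent.

(** [C W C^*] comes from its complement. Adding that complement to the Gram matrix replaces its
    kernel by an identity block, so inverse-closedness yields [C W W C^*]. *)
Lemma frame_inverse_in : A (frame_mx T 0 W) /\ A (frame_mx T 0 (op_comp W W)).
Proof.
have [U UP] := resolvent_exists; have AQ := projection_complement_in UP.
have A1 := bsa_one bA.
have AW : A (frame_mx T 0 W).
  have -> : frame_mx T 0 W = - 1 *: frame_mx T 1 (- W) + opmx_one.
    rewrite -(frame_mx_one T) frame_mxZ frame_mxD mulr1 addNr scaleN1r opprK.
    by rewrite addr0.
  exact: (bsa_lin bA).
split=> //.
have AP : A (frame_mx T 1 (op_id H - W)).
  have -> : frame_mx T 1 (op_id H - W) = 1 *: gram T T + frame_mx T 1 (- W).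
    by rewrite -frame_mx_gram scale1r frame_mxD add0r.
  exact: (bsa_lin bA).
(* This inverse is [C W W C^*] plus the complementary projection, written as one frame matrix. *)
have AN : A (frame_mx T 1 (op_comp W W - W)).
  apply: (spa_inverse_closed spA AP); apply: (frame_mx_inverse b0 upper).
  - by rewrite mulr1.
  - move=> x; rewrite !scale1r.
    rewrite -[(op_id H - W) x]/(x - W x) -[(op_comp W W - W) x]/(W (W x) - W x).
    rewrite -[(op_comp W W - W) _]/(W (W _) - W _) !(op_appB, WS, SW).
    rewrite -[W x - W (W x)]opprB -opprD [_ + (x - W x)]addrC.
    by rewrite subrr.
  - move=> x; rewrite !scale1r.
    rewrite -[(op_id H - W) x]/(x - W x) -[(op_comp W W - W) x]/(W (W x) - W x).
    rewrite -[(op_id H - W) (S _)]/(S _ - W (S _)) !(op_appB, WS, SW).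
    by rewrite -[W x - x]opprB -opprD subrr.
have -> : frame_mx T 0 (op_comp W W) =
    - 1 *: frame_mx T 1 (- W) + frame_mx T 1 (op_comp W W - W).
  by rewrite frame_mxZ frame_mxD mulr1 addNr scaleN1r opprK addrC subrK.
exact: (bsa_lin bA).
Qed.

End Localization.

Theorem theorem3p8 (R : realType) (H : hilbertType R) (X : countType)
    (A : set (opmatrix H X)) (normA : opmatrix H X -> R)
    (T : X -> bounded_op H) :
  separable H ->
  spectral_algebra A normA ->
  gframe T ->
  intrinsically_localized A T ->
  intrinsically_localized A (canonical_dual T) /\
  mutually_localized A T (canonical_dual T).
Proof.
move=> _ spA [a [b [a0 ab TP]]] AG.
have b0 : 0 < b by exact: lt_le_trans ab.
have lower x := (TP x).1; have upper x := (TP x).2.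
have [W [SW WS invE adjW W_le]] := gframe_op_inverse a0 b0 lower upper.
have [AW AWW] := frame_inverse_in spA a0 b0 upper SW WS W_le AG.
(* With [op_inv] replaced by the self-adjoint [W], the adjoint of [T k W] is [W] after the adjoint
   of [T k], so both Gram matrices are frame matrices with scalar [0]. *)
have dualE k : canonical_dual T k = op_comp (T k) W by rewrite /canonical_dual invE.
rewrite /intrinsically_localized /mutually_localized; split.
- suff -> : gram (canonical_dual T) (canonical_dual T) =
    frame_mx T 0 (op_comp W W) by [].
  apply/funext => k; apply/funext => j; apply: bounded_op_eq => x.
  rewrite /frame_mx opD opZ scale0r add0r /gram !dualE.
  by rewrite op_adj_comp adjW.
- suff -> : gram T (canonical_dual T) = frame_mx T 0 W by [].
  apply/funext => k; apply/funext => j; apply: bounded_op_eq => x.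
  rewrite /frame_mx opD opZ scale0r add0r /gram !dualE.
  by rewrite op_adj_comp adjW.
Qed.
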